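(* Let $n\ge 1$ and let $C=\{x\in\mathbb{R}^n: x_1\ge x_2\ge\cdots\ge x_n\ge 0\}$ be the Weyl chamber of $B_n$. Let $\eta$ be an interior point of $C$, $t>0$, and let $N_t(x)=(2\pi t)^{-1/2}e^{-x^2/(2t)}$. For $\lambda$ in the interior of $C$: (1) the density at $\lambda$, at time $t$, of standard $n$-dimensional Brownian motion started at $\eta$ and killed when it first hits the boundary of $C$ is $$b_t(\eta,\lambda)=\det\bigl[N_t(\lambda_i-\eta_j)-N_t(\lambda_i+\eta_j)\bigr]_{i,j=1}^n;$$ (2) the density at $\lambda$, at time $t$, of standard $n$-dimensional Brownian motion started at $\eta$ and reflected at the boundary of $C$ is $$b'_t(\eta,\lambda)=\operatorname{per}\bigl[N_t(\lambda_i-\eta_j)+N_t(\lambda_i+\eta_j)\bigr]_{i,j=1}^n.$$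
   Context: $\operatorname{per}$ denotes the permanent of a matrix. The killed density $b_t(\eta,\cdot)$ is the density of the sub-probability measure $A\mapsto P(X(t)\in A,\ X(s)\in\operatorname{int}C\text{ for all }s\le t)$ for standard Brownian motion $X$ with $X(0)=\eta$. Reflected Brownian motion in $C$ is the process obtained from $X$ by replacing $X(t)$ at each time by the unique point of $C$ in its orbit under the hyperoctahedral group of all coordinate permutations and sign changes. *)

(* Defs.v *)
From HB Require Import structures.
From mathcomp Require Import all_boot all_order all_algebra all_fingroup.
From mathcomp Require Import all_classical all_reals all_analysis.

Set Implicit Arguments.
Unset Strict Implicit.
Unset Printing Implicit Defensive.

Import Order.TTheory GRing.Theory Num.Theory.
Import numFieldNormedType.Exports.

Local Open Scope classical_set_scope.
Local Open Scope ring_scope.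

(* Row vectors carry the sigma-algebra generated by their coordinates; for real
   entries this is the Borel sigma-algebra of the topology of ['rV[R]_n]. *)
Definition measure_row_display : measure_display -> measure_display.
Proof. exact. Qed.

Section measurable_row.
Context {d : measure_display} {T : measurableType d} (n : nat).

Definition row_coord (i : 'I_n) (x : 'rV[T]_n) : T := x ord0 i.

Let row_set0 : g_sigma_preimage row_coord set0.
Proof. exact: sigma_algebra0. Qed.

Let row_setC A : g_sigma_preimage row_coord A ->
  g_sigma_preimage row_coord (~` A).
Proof. exact: sigma_algebraC. Qed.

Let row_bigcup (F : (set 'rV[T]_n)^nat) :
  (forall i, g_sigma_preimage row_coord (F i)) ->
  g_sigma_preimage row_coord (\bigcup_i (F i)).
Proof. exact: sigma_algebra_bigcup. Qed.

HB.instance Definition _ := @isMeasurable.Build (measure_row_display d)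
  'rV[T]_n (g_sigma_preimage row_coord) row_set0 row_setC row_bigcup.

End measurable_row.

Section measurable_row_lemmas.
Context {d d' : measure_display} {T : measurableType d} {T' : measurableType d'}.

Lemma measurable_row_coord n (i : 'I_n) :
  measurable_fun [set: 'rV[T]_n] (row_coord i).
Proof.
move=> _ Y mY; rewrite setTI; apply: sub_sigma_algebra => /=.
rewrite -bigcup_seq/=; exists i => /=; first by rewrite mem_index_enum.
by exists Y => //; rewrite setTI.
Qed.

Lemma measurable_fun_row n (f : T' -> 'rV[T]_n) :
  (forall i, measurable_fun setT (row_coord i \o f)) -> measurable_fun setT f.
Proof.
move=> mf; suff sub : g_sigma_preimage (fun i => row_coord i \o f) `<=` measurable.
  move: sub; rewrite g_sigma_preimage_comp => sub _ A mA.
  by apply: sub; exists A.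
apply: smallest_sub; first exact: sigma_algebra_measurable.
rewrite -bigcup_seq; apply: bigcup_sub => i _ _ [B mB <-].
exact: mf.
Qed.

End measurable_row_lemmas.

Section lebesgue_measure_row.
Context {R : realType}.
Local Open Scope ereal_scope.

Definition row_cons n (p : measurableTypeR R * 'rV[R]_n) : 'rV[R]_n.+1 :=
  \row_i if unlift ord0 i is Some j then p.2 ord0 j else p.1.

Definition row_uncons n (x : 'rV[R]_n.+1) : measurableTypeR R * 'rV[R]_n :=
  (x ord0 ord0, \row_j x ord0 (lift ord0 j)).

Lemma row_consK n : cancel (@row_cons n) (@row_uncons n).
Proof.
move=> [a x]; rewrite /row_uncons /row_cons /= !mxE unlift_none; congr pair.
by apply/rowP => j; rewrite !mxE liftK.
Qed.

Lemma measurable_row_cons n : measurable_fun setT (@row_cons n).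
Proof.
apply: measurable_fun_row => i.
case: (unliftP ord0 i) => [j ->|->].
  rewrite (_ : _ \o _ = row_coord j \o snd).
    by apply: measurableT_comp => //; exact: measurable_row_coord.
  by apply/funext => p /=; rewrite /row_coord mxE liftK.
rewrite (_ : _ \o _ = fst)//.
by apply/funext => p /=; rewrite /row_coord mxE unlift_none.
Qed.

Lemma measurable_row_uncons n : measurable_fun setT (@row_uncons n).
Proof.
apply/measurable_fun_pairP; split; first exact: (measurable_row_coord ord0).
apply: measurable_fun_row => j.
rewrite (_ : _ \o _ = row_coord (lift ord0 j)); first exact: measurable_row_coord.
by apply/funext => x /=; rewrite /row_coord mxE.
Qed.

(* n-dimensional Lebesgue measure, as an n-fold product. *)

Section row_product.
Variables (n : nat) (m : {sigma_finite_measure set 'rV[R]_n -> \bar R}).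

Definition row_product : set 'rV[R]_n.+1 -> \bar R :=
  pushforward (lebesgue_measure \x m) (@row_cons n).

Let measurable_preimage_cons (A : set 'rV[R]_n.+1) : measurable A ->
  measurable (@row_cons n @^-1` A).
Proof.
by move=> mA; rewrite -[X in measurable X]setTI; exact: measurable_row_cons.
Qed.

Let row_product0 : row_product set0 = 0.
Proof. by rewrite /row_product /pushforward preimage_set0 measure0. Qed.

Let row_product_ge0 A : 0 <= row_product A.
Proof. by rewrite /row_product /pushforward; exact: measure_ge0. Qed.

Let row_product_sigma_additive : semi_sigma_additive row_product.
Proof.
move=> F mF tF mUF; rewrite /row_product /pushforward preimage_bigcup.
apply: measure_semi_sigma_additive.
- by move=> i; exact: measurable_preimage_cons.
- apply/trivIsetP => /= i j _ _ ij; rewrite -preimage_setI.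
  by move/trivIsetP : tF => /(_ _ _ _ _ ij) ->//; rewrite preimage_set0.
- by rewrite -preimage_bigcup; exact: measurable_preimage_cons.
Qed.

HB.instance Definition _ := isMeasure.Build _ _ _ row_product
  row_product0 row_product_ge0 row_product_sigma_additive.

Let row_product_sigma_finite : sigma_finite setT row_product.
Proof.
have /sigma_finiteP[F [TF ndF Foo]] := sigma_finiteT (@lebesgue_measure R).
have /sigma_finiteP[G [TG ndG Goo]] := sigma_finiteT m.
exists (fun k => @row_uncons n @^-1` (F k `*` G k)).
  apply/seteqP; split=> // x _.
  have [i _ Fi] : (\bigcup_i F i) (row_uncons x).1 by rewrite -TF.
  have [j _ Gj] : (\bigcup_i G i) (row_uncons x).2 by rewrite -TG.
  exists (maxn i j) => //; split.
    by move: Fi; exact/subsetPset/ndF/leq_maxl.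
  by move: Gj; exact/subsetPset/ndG/leq_maxr.
move=> k; have [mF Fk] := Foo k; have [mG Gk] := Goo k; split.
  rewrite -[X in measurable X]setTI; apply: measurable_row_uncons => //.
  exact: measurableX.
rewrite /row_product /pushforward -comp_preimage.
rewrite (_ : _ \o _ = id); last by apply/funext => p; exact: row_consK.
by rewrite preimage_id product_measure1E// lte_mul_pinfty// ge0_fin_numE.
Qed.

HB.instance Definition _ := Measure_isSigmaFinite.Build _ _ _ row_product
  row_product_sigma_finite.

End row_product.

(* n-dimensional Lebesgue measure, as an n-fold product. *)
Fixpoint lebesgue_row (n : nat) : {sigma_finite_measure set 'rV[R]_n -> \bar R} :=
  if n is n'.+1 then row_product (lebesgue_row n') else \d_(0%R : 'rV[R]_0).

End lebesgue_measure_row.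

Section densities.
Context {R : realType} (n : nat).

(* [mu] is concentrated on [D] and has there the density [f]. Continuity of [f]
   selects the pointwise values of the density, which would otherwise only be
   determined almost everywhere. *)
Definition has_density (mu : set 'rV[R]_n -> \bar R) (D : set 'rV[R]_n)
    (f : 'rV[R]_n -> R) :=
  {within D, continuous f} /\
  forall A : set 'rV[R]_n, measurable A ->
    mu A = (\int[lebesgue_row n]_(x in A `&` D) (f x)%:E)%E.

End densities.

Section brownian_motion.
Context {R : realType} {d : measure_display} {Omega : measurableType d}.
Variable P : probability Omega R.

(* As [A] may take the value [setT], the product rule for the full family gives
   it for all subfamilies. *)
Definition mutually_independent (I : finType) (d' : measure_display)
    (E : measurableType d') (Y : I -> Omega -> E) :=
  forall A : I -> set E, (forall i, measurable (A i)) ->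
    P [set w | forall i, A i (Y i w)] = (\prod_i P (Y i @^-1` A i))%E.

Definition has_normal_law (m s : R) (Y : Omega -> R) :=
  forall A : set R, measurable A -> P (Y @^-1` A) = normal_prob m s A.

(* Only the values of [X] at nonnegative times matter. In [normal_prob], the
   second parameter is the standard deviation. *)
Definition standard_brownian_motion (n : nat) (eta : 'rV[R]_n)
    (X : R -> {RV P >-> 'rV[R]_n}) :=
  [/\ forall w, X 0 w = eta,
      forall w, {within `[0, +oo[, continuous (fun s : R => X s w)},
      forall (k : nat) (tau : nat -> R), 0 <= tau 0%N -> nondecreasing_seq tau ->
        mutually_independent
          (fun (j : 'I_k) w => X (tau j.+1) w - X (tau j) w) &
      forall s t : R, 0 <= s -> s < t ->
        mutually_independent (fun (i : 'I_n) w => (X t w - X s w) ord0 i) /\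
        forall i : 'I_n, has_normal_law 0 (Num.sqrt (t - s))
          (fun w => (X t w - X s w) ord0 i)].

End brownian_motion.

Section weyl_chamber.
Context {R : realType} (n : nat).

Definition weyl_chamber : set 'rV[R]_n :=
  [set x | (forall i j : 'I_n, (i <= j)%N -> x ord0 j <= x ord0 i) /\
           (forall i : 'I_n, 0 <= x ord0 i)].

Definition hyperoctahedral_orbit (x : 'rV[R]_n) : set 'rV[R]_n :=
  [set y | exists (s : 'S_n) (e : 'I_n -> bool),
    y = \row_i ((-1) ^+ e i * x ord0 (s i))].

(* The point of the orbit of [x] that lies in the chamber (it is unique). *)
Definition chamber_fold (x : 'rV[R]_n) : 'rV[R]_n :=
  get (weyl_chamber `&` hyperoctahedral_orbit x).

End weyl_chamber.

Section killed_reflected.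
Context {R : realType} {d : measure_display} {Omega : measurableType d}.
Variables (P : probability Omega R) (n : nat) (X : R -> {RV P >-> 'rV[R]_n}).

Definition killed_law (t : R) (A : set 'rV[R]_n) : \bar R :=
  P [set w | A (X t w) /\
             forall s : R, 0 <= s <= t -> interior (@weyl_chamber R n) (X s w)].

Definition reflected_process (t : R) (w : Omega) : 'rV[R]_n :=
  chamber_fold (X t w).

Definition reflected_law (t : R) (A : set 'rV[R]_n) : \bar R :=
  P (reflected_process t @^-1` A).

End killed_reflected.

Definition permanent (R : comPzRingType) (n : nat) (M : 'M[R]_n) : R :=
  \sum_(s : 'S_n) \prod_i M i (s i).

Definition heat_kernel (R : realType) (t x : R) : R :=
  (2 * pi * t) `^ (- 2^-1) * expR (- (x ^+ 2) / (2 * t)).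

(* Main.v *)
Require Import Defs.
From HB Require Import structures.
From mathcomp Require Import all_boot all_order all_algebra all_fingroup.
From mathcomp Require Import all_classical all_reals all_analysis.
From mathcomp Require Import measurable_realfun.
From mathcomp Require Import ring lra.
Set Implicit Arguments.
Unset Strict Implicit.
Unset Printing Implicit Defensive.

Import Order.TTheory GRing.Theory Num.Theory.
Import numFieldNormedType.Exports.

Local Open Scope classical_set_scope.
Local Open Scope ring_scope.

(** Let W be the hyperoctahedral group, acting on rows by permutations and sign
    changes ([act]), with determinant [sgn]. The increment $X_t - \eta$ is Gaussian
    with independent coordinates of variance t, so the law of $w X_t$ has the density
    $\prod_i N_t(x_i - (w \eta)_i)$ ([gaussian_act_density], [orbit_density]). Expanding
    the determinant and the permanent over permutations and signs ([det_heat],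
    [permanent_heat]) turns the two claims into statements on sums over W, for A
    inside the open chamber:

    - killed: $P(X_t \in A, \text{survival}) = \sum_w \mathrm{sgn}(w) P(w X_t \in A)$;
    - reflected: $P(\text{fold of } X_t \in A) = \sum_w P(w X_t \in A)$.

    The second one holds because an orbit meets the open chamber in at most one
    point, which is reached by a single w ([act_interior_inj]), while the boundary
    is null ([boundary_null]).

    The first one is the reflection principle. Let f be a Lipschitz test function
    vanishing off the open chamber and F its antisymmetrization over W ([antisym]).
    On surviving paths F and f agree at $X_t$, so it suffices that paths which leave
    the chamber contribute nothing to the expectation of $F(X_t)$
    ([survival_expectation]). Instead of stopping Brownian motion at the random time
    of its exit, the path is observed on a finite grid. Given the positions up to the
    first grid time at which some root (see [wall]) is less than $\varepsilon$, the
    remaining increment may be replaced by its image under the reflection in that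
    wall without changing the joint law ([reflection_coupling]). Because F is
    antisymmetric and Lipschitz, averaging the original and the reflected
    expectation gives a bound by the Lipschitz constant times the value of that root
    ([reflection_estimate]). Uniform continuity of the paths makes this value at most
    $\varepsilon$ on a fine grid, up to an event of small probability
    ([exit_estimate]); then the mesh tends to 0, and $\varepsilon$ after it.

    The identity for test functions passes to sets that are limits of such functions
    from below ([lipschitz_approximable]), and from these to all measurable sets by
    the pi-lambda theorem, in a version for real-valued signed set functions
    ([signed_measure_unique]) since the sum over W is alternating. *)

(** * Integrals and signed set functions *)

Section eventually_constant.
Context d (T : measurableType d) (R : realType).
Variable mu : {measure set T -> \bar R}.

Lemma eventually_cvg (u : nat -> R) (l : R) :
  (\forall n \near \oo, u n = l) -> u n @[n --> \oo] --> l.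
Proof.
move=> ul; apply: (@cvg_trans _ (l @[n --> \oo])); last exact: cvg_cst.
by apply: near_eq_cvg; near=> n; apply/esym; near: n.
Unshelve. all: by end_near. Qed.

(** The pointwise convergence of integrands below always stabilizes after finitely
    many steps, so that dominated convergence is only needed in this form. *)
Lemma cvg_Rintegral_eventually (h_ : nat -> T -> R) (h g : T -> R) :
  (forall n, measurable_fun setT (h_ n)) ->
  mu.-integrable setT (EFin \o g) ->
  (forall n x, `|h_ n x| <= g x) ->
  (forall x, \forall n \near \oo, h_ n x = h x) ->
  \int[mu]_x h_ n x @[n --> \oo] --> \int[mu]_x h x.
Proof.
move=> mh ig hg hE.
have cv x : h_ n x @[n --> \oo] --> h x by exact: eventually_cvg.
have mhl : measurable_fun setT h.
  by apply: (measurable_fun_cvg mh) => // x _; exact: cv.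
have cvE x : (h_ n x)%:E @[n --> \oo] --> (h x)%:E.
  by apply: cvg_EFin; [exact: nearW|exact: cv].
have [ih _ cvg] := @dominated_convergence _ T R mu setT measurableT
  (fun n x => (h_ n x)%:E) (fun x => (h x)%:E) (fun x => (g x)%:E)
  (fun n => measurableT_comp (@EFin_measurable R _) (mh n))
  (measurableT_comp (@EFin_measurable R _) mhl)
  (aeW mu (fun x _ => cvE x))
  ig (aeW mu (fun x n _ => hg n x)).
apply: fine_cvg; rewrite fineK//; exact: integrable_fin_num.
Qed.

End eventually_constant.

Lemma Rintegral_sum d (T : measurableType d) (R : realType)
    (mu : {measure set T -> \bar R}) (I : Type) (s : seq I) (h : I -> T -> R) :
  (forall i, mu.-integrable setT (EFin \o h i)) ->
  \int[mu]_x (\sum_(i <- s) h i x) = \sum_(i <- s) \int[mu]_x h i x.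
Proof.
move=> ih; elim: s => [|i s IH].
  by rewrite big_nil -[RHS](Rintegral_set0 mu (cst 0)) /Rintegral integral_set0
    integral0_eq// => x _; rewrite big_nil.
rewrite big_cons -IH -RintegralD//.
  by apply: eq_Rintegral => x _; rewrite big_cons.
rewrite (_ : _ \o _ = (fun x => \sum_(i <- s) (h i x)%:E)%E).
  by apply: integrable_sum => // j _; exact: ih.
by apply/funext => x; rewrite /= sumEFin.
Qed.

Section signed_measures.
Context d (T : measurableType d) (R : realType).
Implicit Types nu : set T -> R.

(** Finite signed measures, reduced to the two properties on which Dynkin's argument
    rests. Being real valued, they can be added with arbitrary signs, as the
    alternating sums over the hyperoctahedral group require. *)
Definition signed_measure nu :=
  (forall A B, measurable A -> measurable B -> B `<=` A ->
     nu (A `\` B) = nu A - nu B) /\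
  (forall F : (set T)^nat, (forall k, measurable (F k)) -> nondecreasing_seq F ->
     nu (F k) @[k --> \oo] --> nu (\bigcup_k F k)).

Lemma signed_measureZ (c : R) nu :
  signed_measure nu -> signed_measure (fun A => c * nu A).
Proof.
move=> [nuD nuU]; split=> [A B mA mB BA|F mF ndF]; first by rewrite nuD// mulrBr.
by apply: cvgMr; exact: nuU.
Qed.

Lemma signed_measure_sum (I : Type) (s : seq I) (nu_ : I -> set T -> R) :
  (forall i, signed_measure (nu_ i)) ->
  signed_measure (fun A => \sum_(i <- s) nu_ i A).
Proof.
move=> snu; split=> [A B mA mB BA|F mF ndF].
  by rewrite -sumrB; apply: eq_bigr => i _; have [-> ] := snu i.
apply: cvg_big => [|i _]; first exact: add_continuous.
by have [_] := snu i; exact.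
Qed.

(** The sets on which both functions agree form a lambda-system. *)
Lemma signed_measure_unique (G : set (set T)) nu1 nu2 :
  setI_closed G -> G setT -> G `<=` measurable -> measurable `<=` <<s G>> ->
  signed_measure nu1 -> signed_measure nu2 ->
  (forall A, G A -> nu1 A = nu2 A) ->
  forall A, measurable A -> nu1 A = nu2 A.
Proof.
move=> GI GT Gm mG [nu1D nu1U] [nu2D nu2U] eqG A mA.
pose H := [set B | measurable B /\ nu1 B = nu2 B].
suff : <<s G>> `<=` H by move=> /(_ A (mG A mA))[].
apply: lambda_system_subset => //.
- split=> //.
  + by split=> //; exact: eqG.
  + move=> B C CB [mB eB] [mC eC]; split; first exact: measurableD.
    by rewrite nu1D// nu2D// eB eC.
  + move=> F ndF HF; have mF k : measurable (F k) by have [] := HF k.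
    split; first exact: bigcupT_measurable.
    have h2 := nu2U F mF ndF; rewrite (_ : (fun k => nu2 (F k)) =
      (fun k => nu1 (F k))) in h2; last by apply/funext => k; have [_ ->] := HF k.
    exact: (cvg_unique _ (nu1U F mF ndF) h2).
- by move=> B GB; split; [exact: Gm|exact: eqG].
Qed.

End signed_measures.

Section integral_signed_measure.
Context d (T : measurableType d) d' (T' : measurableType d') (R : realType).
Variables (mu : {measure set T -> \bar R}) (Y : T -> T') (g : T -> R).
Hypotheses (mY : measurable_fun setT Y) (ig : mu.-integrable setT (EFin \o g)).

Let mg : measurable_fun setT g.
Proof. by apply/measurable_EFinP; exact: (measurable_int mu). Qed.

Let mindic (A : set T') : measurable A ->
  measurable_fun setT (fun x => \1_A (Y x) : R).
Proof. by move=> mA; apply: measurableT_comp mY => //; exact: measurable_indic. Qed.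

Let mgi (A : set T') : measurable A ->
  measurable_fun setT (fun x => g x * \1_A (Y x) : R).
Proof. by move=> mA; apply: measurable_funM => //; exact: mindic. Qed.

Let norm_indic_le (A : set T') x : `|g x * \1_A (Y x)| <= `|g x|.
Proof. by rewrite normrM indicE; case: (_ \in _);
  rewrite ?normr1 ?mulr1// normr0 mulr0. Qed.

Lemma integrable_mul_indic (A : set T') : measurable A ->
  mu.-integrable setT (EFin \o (fun x => g x * \1_A (Y x))).
Proof.
move=> mA; apply: (le_integrable measurableT _ _ ig).
  by apply/measurable_EFinP; exact: mgi.
by move=> x _; rewrite /= lee_fin.
Qed.

Lemma signed_measure_integral :
  signed_measure (fun A => \int[mu]_x (g x * \1_A (Y x))).
Proof.
split=> [A B mA mB BA|F mF ndF].
  rewrite -RintegralB//; [|exact: integrable_mul_indic..].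
  apply: eq_Rintegral => x _; rewrite -mulrBr; congr (_ * _).
  rewrite !indicE in_setD; have [yB|yB] := boolP (Y x \in B).
    by rewrite (mem_set (BA _ (set_mem yB))) subrr.
  by rewrite andbT subr0.
apply: (@cvg_Rintegral_eventually _ _ _ mu _ _ (fun x => `|g x|)).
- by move=> n; exact: mgi.
- exact: integrable_norm.
- by move=> n x; exact: norm_indic_le.
- move=> x; have [[k _ Fk]|nF] := pselect ((\bigcup_k F k) (Y x)).
    near=> n; congr (_ * _); rewrite !indicE.
    rewrite [in RHS]mem_set; last by exists k.
    rewrite mem_set//.
    have /ndF/subsetPset : (k <= n)%N by near: n; exact: nbhs_infty_ge.
    exact.
  near=> n; congr (_ * _); rewrite !indicE [in RHS]memNset// memNset// => Fn.
  by apply: nF; exists n.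
Unshelve. all: by end_near. Qed.

End integral_signed_measure.

(** * Boxes and Lebesgue measure on row vectors *)

Section boxes.
Context d (T : measurableType d) (R : realType) (n : nat).

Definition box (B : 'I_n -> set T) : set 'rV[T]_n :=
  [set x | forall i, B i (x ord0 i)].

Lemma measurable_box (B : 'I_n -> set T) :
  (forall i, measurable (B i)) -> measurable (box B).
Proof.
move=> mB; rewrite (_ : box B = \bigcap_(i in setT) (row_coord i @^-1` B i)).
  apply: fin_bigcap_measurable => // i _.
  by rewrite -[X in measurable X]setTI; exact: measurable_row_coord.
by apply/seteqP; split => [x Bx i _|x Bx i]; [exact: Bx|exact: (Bx i)].
Qed.

Lemma row_sigma_algebraW (G : set (set 'rV[T]_n)) :
  (forall i B, measurable B -> <<s G>> (row_coord i @^-1` B)) ->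
  measurable `<=` <<s G>>.
Proof.
move=> GB; apply: smallest_sub; first exact: smallest_sigma_algebra.
by rewrite -bigcup_seq; apply: bigcup_sub => i _ _ [B mB <-]; rewrite setTI;
  exact: GB.
Qed.

(** Boxes form a pi-system, which contains the preimages of measurable sets under the
    coordinates. *)
Lemma row_signed_measure_unique (nu1 nu2 : set 'rV[T]_n -> R) :
  signed_measure nu1 -> signed_measure nu2 ->
  (forall B, (forall i, measurable (B i)) -> nu1 (box B) = nu2 (box B)) ->
  forall A, measurable A -> nu1 A = nu2 A.
Proof.
move=> snu1 snu2 eqB.
pose G := [set A | exists2 B, (forall i, measurable (B i)) & A = box B].
apply: (@signed_measure_unique _ _ _ G) => //.
- move=> _ _ [B mB ->] [C mC ->]; exists (fun i => B i `&` C i).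
    by move=> i; exact: measurableI.
  by apply/seteqP; split => [x [Bx Cx] i|x BCx]; split => // i; have [] := BCx i.
- by exists (fun=> setT) => //; apply/seteqP; split.
- by move=> _ [B mB ->]; exact: measurable_box.
- apply: row_sigma_algebraW => i B mB; apply: sub_sigma_algebra.
  exists (fun j => if j == i then B else setT).
    by move=> j; case: ifP.
  apply/seteqP; split => [x Bx j|x /(_ i)]; last by rewrite eqxx.
  by case: ifPn => // /eqP ->.
- by move=> _ [B mB ->]; exact: eqB.
Qed.

End boxes.

Section lebesgue_row_product.
Context {R : realType}.
Local Notation mu := (@lebesgue_measure R).
Local Open Scope ereal_scope.

Lemma measurable_prod_row n (h : 'I_n -> R -> R) :
  (forall i, measurable_fun setT (h i)) ->
  measurable_fun setT (fun x : 'rV[R]_n => \prod_i h i (x ord0 i))%R.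
Proof.
move=> mh; apply: measurable_prod => i _.
by apply: measurableT_comp => //; exact: measurable_row_coord.
Qed.

(** Tonelli's theorem, applied to one coordinate at a time along the recursion that
    defines [lebesgue_row]. *)
Lemma integral_lebesgue_row_prod n (h : 'I_n -> R -> R) :
  (forall i, measurable_fun setT (h i)) -> (forall i x, (0 <= h i x)%R) ->
  (forall i, mu.-integrable setT (EFin \o h i)) ->
  \int[lebesgue_row n]_x (\prod_i h i (x ord0 i))%:E =
  \prod_i \int[mu]_x (h i x)%:E.
Proof.
elim: n h => [|n IH] h mh h0 ih.
  rewrite big_ord0 /= integral_dirac//.
    by rewrite diracT mul1e big_ord0.
  by apply/measurable_EFinP; exact: measurable_prod_row.
have mprod k (g : 'I_k -> R -> R) : (forall i, measurable_fun setT (g i)) ->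
    measurable_fun setT (fun x : 'rV[R]_k => (\prod_i g i (x ord0 i))%:E).
  by move=> mg; apply/measurable_EFinP; exact: measurable_prod_row.
have prod0 k (g : 'I_k -> R -> R) : (forall i x, (0 <= g i x)%R) ->
    forall x : 'rV[R]_k, 0 <= (\prod_i g i (x ord0 i))%:E.
  by move=> g0 x; rewrite lee_fin prodr_ge0.
have h'0 i x : (0 <= h (lift ord0 i) x)%R by [].
rewrite big_ord_recl -IH//=.
rewrite ge0_integral_pushforward//; first last.
- by move=> x _; exact: (prod0 _ h).
- exact: (mprod _ _ mh).
- exact: measurable_row_cons.
rewrite preimage_setT fubini_tonelli1; first last.
- by move=> x; exact: (prod0 _ h).
- by apply: measurableT_comp; [exact: (mprod _ _ mh)|exact: measurable_row_cons].
transitivity (\int[mu]_a ((h ord0 a)%:E *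
    \int[lebesgue_row n]_x (\prod_i h (lift ord0 i) (x ord0 i))%:E)).
  apply: eq_integral => a _; rewrite -ge0_integralZl//; first last.
  - by rewrite lee_fin.
  - by move=> x _; exact: (prod0 _ (fun i => h (lift ord0 i))).
  - exact: (mprod _ (fun i => h (lift ord0 i))).
  apply: eq_integral => x _ /=; rewrite -EFinM big_ord_recl; congr (_ * _)%:E.
    by rewrite mxE unlift_none.
  by apply: eq_bigr => i _; rewrite mxE liftK.
rewrite ge0_integralZr//.
- by apply/measurable_EFinP; exact: mh.
- by move=> x _; rewrite lee_fin.
- by apply: integral_ge0 => x _; exact: (prod0 _ (fun i => h (lift ord0 i))).
Qed.

End lebesgue_row_product.

(** * Normal laws on the line *)

Section pushforward_measures.
Context d1 d2 (X : measurableType d1) (Y : measurableType d2) (R : realType).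

(** The measurability of [phi] is an argument, so that the image carries its measure
    structure. *)
Definition image_measure (mu : {measure set X -> \bar R}) (phi : X -> Y)
    (mphi : measurable_fun setT phi) : {measure set Y -> \bar R} :=
  measure_function_pushforward__canonical__measure_function_Measure mu mphi.

End pushforward_measures.

Section one_dimensional_normal.
Context {R : realType}.
Local Notation mu := (@lebesgue_measure R).

Definition affine_sign (e : bool) (c x : R) : R := (-1) ^+ e * x + c.

Lemma measurable_affine_sign e c :
  measurable_fun [set: measurableTypeR R] (affine_sign e c : _ ->
    measurableTypeR R).
Proof.
by apply: measurable_funD => //; apply: measurable_funM.
Qed.

(** Symmetries and translations of the line preserve the length of half-open
    intervals, which determines Lebesgue measure. *)
Lemma lebesgue_measure_affine_sign e c (A : set (measurableTypeR R)) :
  measurable A -> mu (affine_sign e c @^-1` A) = mu A.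
Proof.
move=> mA; apply/esym; move: A mA.
apply: (@lebesgue_measure_unique _ (image_measure mu (measurable_affine_sign e c))).
move=> _ [[a b] _ <-] /=; rewrite /pushforward.
have -> : affine_sign e c @^-1` `]a, b] =
    if e then `[c - b, c - a[%classic else `]a - c, b - c]%classic.
  apply/seteqP; split => x; case: e; rewrite /affine_sign /= ?in_itv/= ?in_itv/=;
    rewrite ?mulN1r ?mul1r; move=> /andP[? ?]; apply/andP; split; lra.
case: e; rewrite !lebesgue_measure_itv/= !lte_fin -!EFinD.
- by rewrite ltrD2l ltrN2; case: ifP => // _; congr EFin; lra.
- by rewrite ltrD2r; case: ifP => // _; congr EFin; lra.
Qed.

Lemma heat_kernelE (t c x : R) : 0 < t ->
  heat_kernel t (x - c) = normal_pdf c (Num.sqrt t) x.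
Proof.
move=> t0; rewrite normal_pdfE ?gt_eqF ?sqrtr_gt0// /heat_kernel.
rewrite /normal_peak /normal_fun sqr_sqrtr ?ltW//.
congr (_ * expR (_ / _)); last by rewrite mulr_natl.
rewrite powRN powR12_sqrt; last by rewrite !mulr_ge0 ?pi_ge0 ?ltW.
by congr (Num.sqrt _)^-1; rewrite -mulr_natr; ring.
Qed.

Lemma heat_kernel_sign (t x : R) (e : bool) : heat_kernel t ((-1) ^+ e * x) =
  heat_kernel t x.
Proof. by rewrite /heat_kernel exprMn -exprM mulnC exprM sqrrN !expr1n mul1r. Qed.

(** The heat kernel is even: a change of sign leaves a centred normal density as it
    is, and adding [c] moves its centre to [c]. *)
Lemma normal_law_affine_sign d (Omega : measurableType d) (P : probability Omega R)
    (Y : Omega -> R) (t : R) (e : bool) (c : R) :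
  0 < t -> has_normal_law P 0 (Num.sqrt t) Y ->
  forall A : set R, measurable A ->
    P ((fun w => (-1) ^+ e * Y w + c) @^-1` A) =
    (\int[mu]_(x in A) (heat_kernel t (x - c))%:E)%E.
Proof.
move=> t0 nY A mA.
have mf : measurable_fun setT (fun x : measurableTypeR R =>
  (heat_kernel t (x - c))%:E).
  apply/measurable_EFinP; rewrite (_ : (fun _ => _) = normal_pdf c (Num.sqrt t)).
    exact: measurable_normal_pdf.
  by apply/funext => x; rewrite heat_kernelE.
have mAf : measurable (affine_sign e c @^-1` A).
  by rewrite -[X in measurable X]setTI; exact: measurable_affine_sign.
transitivity (P (Y @^-1` (affine_sign e c @^-1` A))); first by [].
rewrite nY// /normal_prob.
transitivity (\int[image_measure mu (measurable_affine_sign e c)]_(x in A)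
    (heat_kernel t (x - c))%:E)%E; last first.
  by apply: eq_measure_integral => B mB _; exact: lebesgue_measure_affine_sign.
rewrite ge0_integral_pushforward//; first last.
- by move=> x _; rewrite lee_fin heat_kernelE// normal_pdf_ge0.
- exact: measurable_funTS.
- exact: measurable_affine_sign.
apply: eq_integral => x _ /=.
by rewrite /affine_sign addrK heat_kernel_sign -[in RHS](subr0 x) heat_kernelE.
Qed.

End one_dimensional_normal.

(** * Laws of random rows *)

Section expectations.
Context d (Omega : measurableType d) (R : realType) (P : probability Omega R).

Lemma integrable_bounded (h : Omega -> R) (M : R) :
  measurable_fun setT h -> (forall w, `|h w| <= M) ->
  P.-integrable setT (EFin \o h).
Proof.
move=> mh hM; apply: measurable_bounded_integrable => //.
  by rewrite (le_lt_trans (probability_le1 _ _)) ?ltry.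
exists M; split; first exact: num_real.
by move=> x Mx w _; apply: (le_trans (hM w)); exact: ltW.
Qed.

Lemma expectation_indic d' (T : measurableType d') (Y : Omega -> T) (A : set T) :
  measurable_fun setT Y -> measurable A ->
  \int[P]_w \1_A (Y w) = fine (P (Y @^-1` A)).
Proof.
move=> mY mA; have mYA : measurable (Y @^-1` A).
  by rewrite -[X in measurable X]setTI; exact: mY.
by rewrite -[X in P X]setIT -integral_indic.
Qed.

Lemma signed_measure_law d' (T : measurableType d') (Y : Omega -> T) :
  measurable_fun setT Y -> signed_measure (fun A => fine (P (Y @^-1` A))).
Proof.
move=> mY.
have /(signed_measure_integral mY)[nuD nuU] :
    P.-integrable setT (EFin \o cst (1 : R)).
  by apply: (@integrable_bounded _ 1) => // w; rewrite normr1.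
have E A : measurable A -> \int[P]_w (1 * \1_A (Y w)) = fine (P (Y @^-1` A)).
  move=> mA; rewrite -expectation_indic//.
  by apply: eq_Rintegral => w _; rewrite mul1r.
split=> [A B mA mB BA|F mF ndF].
  by rewrite -!E//; [exact: nuD|exact: measurableD].
rewrite -E; last exact: bigcupT_measurable.
rewrite (_ : (fun _ => _) = (fun k => \int[P]_w (1 * \1_(F k) (Y w)))).
  exact: nuU.
by apply/funext => k; rewrite E.
Qed.

Lemma eq_law_boxes n d' (T : measurableType d') (Y Y' : Omega -> 'rV[T]_n) :
  measurable_fun setT Y -> measurable_fun setT Y' ->
  (forall B, (forall i, measurable (B i)) ->
    P (Y @^-1` box B) = P (Y' @^-1` box B)) ->
  forall A, measurable A -> P (Y @^-1` A) = P (Y' @^-1` A).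
Proof.
move=> mY mY' eqB A mA; have mYA : measurable (Y @^-1` A).
  by rewrite -[X in measurable X]setTI; exact: mY.
have mYA' : measurable (Y' @^-1` A).
  by rewrite -[X in measurable X]setTI; exact: mY'.
rewrite -[LHS]fineK ?fin_num_measure// -[RHS]fineK ?fin_num_measure//; congr EFin.
move: A mA {mYA mYA'}; apply: row_signed_measure_unique.
- exact: signed_measure_law.
- exact: signed_measure_law.
- by move=> B mB; rewrite eqB.
Qed.

(** Both sides are integrals of [h] against the common image of [P]. *)
Lemma eq_law_expectation d' (T : measurableType d') (Y Y' : Omega -> T)
    (h : T -> R) (M : R) :
  measurable_fun setT Y -> measurable_fun setT Y' ->
  (forall A, measurable A -> P (Y @^-1` A) = P (Y' @^-1` A)) ->
  measurable_fun setT h -> (forall x, `|h x| <= M) ->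
  \int[P]_w h (Y w) = \int[P]_w h (Y' w).
Proof.
move=> mY mY' eqA mh hM.
congr fine.
have -> : (\int[P]_w (h (Y w))%:E = \int[image_measure P mY]_x (h x)%:E)%E.
  rewrite integral_pushforward//; first exact/measurable_EFinP.
  by apply: integrable_bounded => //; exact: measurableT_comp.
have -> : (\int[P]_w (h (Y' w))%:E = \int[image_measure P mY']_x (h x)%:E)%E.
  rewrite integral_pushforward//; first exact/measurable_EFinP.
  by apply: integrable_bounded => //; exact: measurableT_comp.
by apply: eq_measure_integral => A mA _; exact: eqA.
Qed.

End expectations.

(** * The hyperoctahedral group and Gaussian rows *)

Section signed_permutations.
Context {R : realType} (n : nat).

(** The hyperoctahedral group: a permutation together with a choice of signs. *)
Definition signed_perm := ('S_n * {ffun 'I_n -> bool})%type.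

Definition act (w : signed_perm) (x : 'rV[R]_n) : 'rV[R]_n :=
  \row_i ((-1) ^+ w.2 i * x ord0 (w.1 i)).

Lemma measurable_act w : measurable_fun setT (act w).
Proof.
apply: measurable_fun_row => i.
rewrite (_ : _ \o _ = (fun x : 'rV[R]_n => (-1) ^+ w.2 i * row_coord (w.1 i) x)).
  by apply: measurable_funM => //; exact: measurable_row_coord.
by apply/funext => x; rewrite /row_coord/= mxE.
Qed.

Lemma measurable_row_add d (T : measurableType d) (Y Z : T -> 'rV[R]_n) :
  measurable_fun [set: T] Y -> measurable_fun setT Z ->
  measurable_fun setT (fun w : T => Y w + Z w).
Proof.
move=> mY mZ; apply: measurable_fun_row => i.
rewrite (_ : _ \o _ = (row_coord i \o Y) \+ (row_coord i \o Z)).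
  by apply: measurable_funD; apply: measurableT_comp => //;
    exact: measurable_row_coord.
by apply/funext => x; rewrite /row_coord/= mxE.
Qed.

End signed_permutations.

Section gaussian_rows.
Context d (Omega : measurableType d) (R : realType) (P : probability Omega R).
Variables (n : nat) (t : R) (xi : Omega -> 'rV[R]_n).
Local Notation mu := (@lebesgue_measure R).
Hypotheses (t0 : 0 < t) (mxi : measurable_fun setT xi)
  (ind : mutually_independent P (fun i w => xi w ord0 i))
  (law : forall i, has_normal_law P 0 (Num.sqrt t) (fun w => xi w ord0 i)).

Let measurable_affine e c (B : set R) : measurable B ->
  measurable (affine_sign e c @^-1` B).
Proof.
by move=> mB; rewrite -[X in measurable X]setTI; exact: measurable_affine_sign.
Qed.

(** [act g] permutes the independent coordinates up to sign, so the probability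
    factors, and each factor concerns one signed and shifted normal variable. *)
Lemma gaussian_act_box (g : signed_perm n) (c : 'rV[R]_n) (B : 'I_n -> set R) :
  (forall i, measurable (B i)) ->
  P ((fun w => act g (xi w) + c) @^-1` box B) =
  (\prod_i \int[mu]_(x in B i) (heat_kernel t (x - c ord0 i))%:E)%E.
Proof.
move=> mB; pose A j := affine_sign (g.2 ((g.1^-1)%g j)) (c ord0 ((g.1^-1)%g j))
  @^-1` B ((g.1^-1)%g j).
have -> : (fun w => act g (xi w) + c) @^-1` box B =
    [set w | forall j, A j (xi w ord0 j)].
  apply/seteqP; split => [w Bw j|w Aw i] /=.
    by have := Bw ((g.1^-1)%g j); rewrite !mxE permKV.
  by have := Aw (g.1 i); rewrite /A !mxE permK.
rewrite ind; last by move=> j; exact: measurable_affine.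
rewrite (reindex_inj (@perm_inj _ g.1)); apply: eq_bigr => i _.
by rewrite /A permK -(normal_law_affine_sign (g.2 i) _ t0 (law (g.1 i)))//.
Qed.

Let mheat (c : R) : measurable_fun setT (fun x : R => heat_kernel t (x - c)).
Proof.
rewrite (_ : (fun _ => _) = normal_pdf c (Num.sqrt t)).
  exact: measurable_normal_pdf.
by apply/funext => x; rewrite heat_kernelE.
Qed.

Let heat_ge0 x : 0 <= heat_kernel t x.
Proof. by rewrite /heat_kernel mulr_ge0 ?powR_ge0 ?expR_ge0. Qed.

Let iheat (c : R) : mu.-integrable setT (EFin \o (fun x : R =>
  heat_kernel t (x - c))).
Proof.
rewrite (_ : _ \o _ = (fun x => (normal_pdf c (Num.sqrt t) x)%:E)).
  exact: integrable_normal_pdf.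
by apply/funext => x; rewrite /= heat_kernelE.
Qed.

Lemma integrable_heat_prod (c : 'rV[R]_n) :
  (lebesgue_row n).-integrable setT
    (EFin \o (fun x : 'rV[R]_n => \prod_i heat_kernel t (x ord0 i - c ord0 i))).
Proof.
apply/integrableP; split.
  apply/measurable_EFinP.
  exact: (@measurable_prod_row _ _ (fun i x => heat_kernel t (x - c ord0 i))).
under eq_integral => x _.
  rewrite gee0_abs; last by rewrite lee_fin prodr_ge0.
  over.
rewrite (@integral_lebesgue_row_prod _ _ (fun i x =>
  heat_kernel t (x - c ord0 i)))//.
rewrite big1 ?ltry// => i _;
  rewrite -[RHS](integral_normal_pdf (c ord0 i) (Num.sqrt t)).
by apply: eq_integral => x _; rewrite heat_kernelE.
Qed.

(** Both sides are signed measures in [A]; on boxes they factor over the coordinates. *)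
Lemma gaussian_act_density (g : signed_perm n) (c : 'rV[R]_n) (A : set 'rV[R]_n) :
  measurable A ->
  fine (P ((fun w => act g (xi w) + c) @^-1` A)) =
  \int[lebesgue_row n]_x (\prod_i heat_kernel t (x ord0 i - c ord0 i) * \1_A x).
Proof.
move: A; apply: row_signed_measure_unique.
- apply: signed_measure_law; apply: measurable_row_add => //.
  by apply: measurableT_comp => //; exact: measurable_act.
- apply: (@signed_measure_integral _ _ _ _ _ _ id) => //.
  exact: integrable_heat_prod.
- move=> B mB; rewrite gaussian_act_box//; congr fine.
  pose h i x : R := heat_kernel t (x - c ord0 i) * \1_(B i) x.
  have mh i : measurable_fun setT (h i).
    by apply: measurable_funM => //; exact: measurable_indic.
  have hE i : (\int[mu]_x (h i x)%:E =
      \int[mu]_(x in B i) (heat_kernel t (x - c ord0 i))%:E)%E.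
    rewrite [RHS]integral_mkcond; apply: eq_integral => x _.
    by rewrite /h patchE indicE; case: (_ \in _); rewrite ?mulr1 ?mulr0.
  transitivity (\int[lebesgue_row n]_x (\prod_i h i (x ord0 i))%:E)%E.
    rewrite integral_lebesgue_row_prod//.
    + by apply: eq_bigr => i _; rewrite hE.
    + by move=> i x; rewrite mulr_ge0.
    + move=> i; apply: (le_integrable measurableT _ _ (iheat (c ord0 i))).
        by apply/measurable_EFinP; exact: mh.
      move=> x _; rewrite /= lee_fin /h normrM ler_piMr// indicE.
      by case: (_ \in _); rewrite ?normr1 ?normr0.
  apply: eq_integral => x _; congr EFin; rewrite big_split/=; congr (_ * _).
  rewrite indicE; have [Bx|Bx] := boolP (x \in box B).
    by rewrite big1// => i _; rewrite indicE mem_set//; exact: (set_mem Bx).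
  have [i nBi] : exists i, ~ B i (x ord0 i).
    by apply/existsNP => Bx'; move/negP: Bx; apply; exact: mem_set.
  by rewrite (bigD1 i)//= indicE memNset// mul0r.
Qed.

(** The symmetry behind the reflection principle: the law of a centred Gaussian row
    with independent coordinates of equal variance is hyperoctahedrally invariant. *)
Lemma gaussian_act_sym (g : signed_perm n) (B : 'I_n -> set R) :
  (forall i, measurable (B i)) ->
  P ((fun w => act g (xi w)) @^-1` box B) = P (xi @^-1` box B).
Proof.
move=> mB; have actE g' : (fun w => act g' (xi w)) = (fun w => act g' (xi w) + 0).
  by apply/funext => w; rewrite addr0.
have xiE : xi = (fun w => act (1%g, [ffun=> false]) (xi w)).
  by apply/funext => w; apply/rowP => i; rewrite mxE ffunE perm1 mul1r.
by rewrite actE gaussian_act_box// [in RHS]xiE actE gaussian_act_box.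
Qed.

End gaussian_rows.

(** * The chamber and its walls *)

Section chamber.
Context {R : realType} (n : nat).
Implicit Types (x y : 'rV[R]_n) (i j : 'I_n) (w : signed_perm n).

(** Reading coordinates past the last one as 0 gives the wall $x_n = 0$ the same form
    as the walls $x_i = x_{i+1}$. *)
Definition entry x (k : nat) : R := if insub k is Some i then x ord0 i else 0.

(** The simple roots of $B_n$; the chamber is where they are all nonnegative. *)
Definition wall i x : R := x ord0 i - entry x i.+1.

Lemma entryE x i : entry x i = x ord0 i.
Proof. by rewrite /entry insubT //= => ?; congr (x _ _); exact: val_inj. Qed.

Lemma entry_ge x k : (n <= k)%N -> entry x k = 0.
Proof. by move=> nk; rewrite /entry insubF// ltnNge nk. Qed.

Lemma entry_le x i (k : nat) : (forall i, 0 <= wall i x) -> (i <= k)%N ->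
  entry x k <= x ord0 i.
Proof.
move=> x0; elim: k => [|k IH].
  by rewrite leqn0 -entryE => /eqP ->.
rewrite leq_eqVlt => /predU1P[<-|]; first by rewrite entryE.
rewrite ltnS => /IH; apply: le_trans.
have [kn|nk] := ltnP k n; last by rewrite !entry_ge// ltnW.
by have := x0 (Ordinal kn); rewrite /wall subr_ge0 -entryE.
Qed.

Lemma weyl_chamberP x : @weyl_chamber R n x <-> forall i, 0 <= wall i x.
Proof.
split=> [[xD x0] i|x0].
  rewrite subr_ge0; have [i1n|ni1] := ltnP i.+1 n; last by rewrite entry_ge.
  by rewrite (entryE x (Ordinal i1n)); apply: xD => /=.
split=> [i j ij|i]; first by rewrite -(entryE x j); exact: entry_le.
by rewrite -(@entry_ge x n)//; apply: entry_le => //; exact: ltnW.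
Qed.

Lemma wall_gt0_lt x i j : (forall i, 0 < wall i x) -> (i < j)%N ->
  x ord0 j < x ord0 i.
Proof.
move=> x0 ij; have /weyl_chamberP[xD _] : forall i, 0 <= wall i x by move=> k;
  exact: ltW.
have i1n : (i.+1 < n)%N by exact: leq_ltn_trans ij (ltn_ord j).
have := x0 i; rewrite subr_gt0 (entryE x (Ordinal i1n)); apply: le_lt_trans.
exact: xD.
Qed.

Lemma wall_gt0_gt0 x i : (forall i, 0 < wall i x) -> 0 < x ord0 i.
Proof.
move=> x0; apply: lt_le_trans (x0 i) _; rewrite gerBl /entry.
case: insubP => // j _ _.
by have /weyl_chamberP[_ ->] : forall i, 0 <= wall i x by move=> k; exact: ltW.
Qed.

Lemma wall_lipschitz i x y : `|wall i x - wall i y| <= \sum_j `|x ord0 j - y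
  ord0 j|.
Proof.
rewrite /wall; have [i1n|ni1] := ltnP i.+1 n; last first.
  by rewrite !entry_ge// !subr0 (bigD1 i)//= lerDl sumr_ge0.
have ne : Ordinal i1n != i by rewrite -val_eqE/= gtn_eqF.
rewrite !(entryE _ (Ordinal i1n)) (bigD1 i)//= (bigD1 (Ordinal i1n))//= addrA.
rewrite [X in `|X|](_ : _ = (x ord0 i - y ord0 i) -
  (x ord0 (Ordinal i1n) - y ord0 (Ordinal i1n))); last by ring.
by apply: (le_trans (ler_normB _ _)); rewrite lerDl sumr_ge0.
Qed.

Lemma measurable_wall i : measurable_fun setT (wall i).
Proof.
apply: measurable_funB; first exact: (@measurable_row_coord _ _ n i).
rewrite /entry; case: insubP => [j _ _|_] //.
exact: (@measurable_row_coord _ _ n j).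
Qed.

Lemma wall_continuous i : continuous (wall i).
Proof.
move=> x; have c1 := @coord_continuous R 1 n ord0 i x.
have c2 : entry y i.+1 @[y --> x] --> entry x i.+1.
  rewrite /entry; case: insubP => [j _ _|_];
    last by apply: (@cvg_cst R (0 : R) _ (nbhs x) (nbhs_filter x)).

  exact: (@coord_continuous R 1 n ord0 j x).
exact: (cvgB c1 c2).
Qed.

(** If a ball of radius [e] around [x] lies in the chamber, coordinate [i] can be
    lowered by [e / 2] without leaving it, and this lowers root [i] by [e / 2]. *)
Lemma interior_weyl_chamberP x :
  interior (@weyl_chamber R n) x <-> forall i, 0 < wall i x.
Proof.
split=> [|x0].
  move=> /nbhs_ballP[e /= e0 xe] i.
  (* The point x with coordinate i lowered by e / 2. *)
  pose y := \row_j (x ord0 j - (e / 2) *+ (j == i)).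
  have /weyl_chamberP/(_ i) : @weyl_chamber R n y.
    apply: xe; split=> // a j;
      rewrite mxE (ord1 a) /ball /= opprB addrCA subrr addr0.
    case: (j == i); rewrite ?normr0//= ger0_norm ?divr_ge0 ?ltW//.
    by rewrite ltr_pdivrMr// ltr_pMr// ltr1n.
  rewrite /wall mxE eqxx mulr1n (_ : entry y i.+1 = entry x i.+1); last first.
    rewrite /entry; case: insubP => // j _ ji; rewrite mxE.
    by rewrite -val_eqE/= ji gtn_eqF// subr0.
  by rewrite addrAC subr_ge0; move=> h; apply: lt_le_trans h; exact: divr_gt0.
have : \forall y \near x, forall i, 0 < wall i y.
  apply: (@filter_forall _ _ (fun i y => 0 < wall i y) (nbhs x)) => i.
  by apply: (@cvgr_gt _ _ (nbhs x) _ (wall i) (wall i x)) => //;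
    exact: wall_continuous.
by apply: filterS => y y0; apply/weyl_chamberP => i; exact: ltW.
Qed.

(** Sort the absolute values of the coordinates and make all signs positive. *)
Lemma signed_perm_exists x : exists w, @weyl_chamber R n (act w x).
Proof.
(* Lists are sorted in decreasing order. *)
pose r (a b : R) := b <= a.
pose t := [tuple `|x ord0 i| | i < n].
have /tuple_permP[s sE] : perm_eq (sort r t) t by rewrite perm_sort.
exists (s, [ffun i => x ord0 (s i) < 0]).
have actE i : act (s, [ffun i => x ord0 (s i) < 0]) x ord0 i = `|x ord0 (s i)|.
  rewrite mxE ffunE /=; case: ltrP => [x0|x0]; first by rewrite ltr0_norm// mulN1r.
  by rewrite ger0_norm// mul1r.
have nthE i : nth 0 (sort r t) i = `|x ord0 (s i)|.
  rewrite sE -[RHS](tnth_mktuple (fun i => `|x ord0 (s i)|)) (tnth_nth 0).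
  congr nth; apply: (congr1 val); apply: eq_from_tnth => j.
  by rewrite !tnth_mktuple.
have rt : transitive r by move=> b a c ba cb; exact: le_trans cb ba.
have st : sorted r (sort r t) by apply: sort_sorted => a b; rewrite /r le_total.
split=> [i j ij|i]; last by rewrite actE.
rewrite !actE -!nthE; apply: (@sorted_leq_nth _ r) => //.
- by move=> a; rewrite /r.
- by rewrite inE size_sort size_tuple.
- by rewrite inE size_sort size_tuple.
Qed.

Lemma act_chamber_norm w x : @weyl_chamber R n (act w x) ->
  forall i, act w x ord0 i = `|x ord0 (w.1 i)|.
Proof.
move=> [_ w0] i; rewrite -(ger0_norm (w0 i)) mxE normrM normrX normrN1 expr1n.
by rewrite mul1r.
Qed.

(** A point of the chamber in the orbit of [x] lists the absolute values of the
    coordinates of [x] in decreasing order, and a sorted list is unique. *)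
Lemma act_chamber_unique v w x : @weyl_chamber R n (act v x) ->
  @weyl_chamber R n (act w x) -> act v x = act w x.
Proof.
move=> Cv Cw; pose r (a b : R) := b <= a.
have rt : transitive r by move=> b a c ba cb; exact: le_trans cb ba.
have ra : antisymmetric r by move=> a b /andP[ab ba];
  exact: le_anti (introT andP (conj ba ab)).
have srt u : @weyl_chamber R n (act u x) ->
    sorted r [seq act u x ord0 i | i <- enum 'I_n].
  move=> [uD _]; rewrite sorted_map.
  apply: (@sub_sorted _ (relpre val leq)) => [i j ij|]; first exact: uD.
  by rewrite -sorted_map val_enum_ord iota_sorted.
have prm u : @weyl_chamber R n (act u x) ->
    perm_eq [seq act u x ord0 i | i <- enum 'I_n] [seq `|x ord0 i| | i <- enum
      'I_n].
  move=> Cu; have -> : [seq act u x ord0 i | i <- enum 'I_n] =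
      [seq `|x ord0 i| | i <- [seq u.1 i | i <- enum 'I_n]].
    by rewrite -[RHS]map_comp; apply: eq_map => i /=; exact: act_chamber_norm.
  apply: perm_map; apply: uniq_perm => [||i].
  - by rewrite map_inj_uniq ?enum_uniq//; exact: (@perm_inj _ u.1).
  - exact: enum_uniq.
  - rewrite mem_enum; apply/mapP; exists ((u.1^-1)%g i); rewrite ?mem_enum//.
    by rewrite permKV.
have /(sorted_eq rt ra (srt _ Cv) (srt _ Cw))/eq_in_map E :
    perm_eq [seq act v x ord0 i | i <- enum 'I_n] [seq act w x ord0 i | i <-
      enum 'I_n].
  by rewrite (perm_trans (prm _ Cv))// perm_sym prm.
by apply/rowP => i; apply: E; rewrite mem_enum.
Qed.

(** An increasing permutation moves no index down; neither does its inverse. *)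
Lemma increasing_perm_id (s : 'S_n) :
  (forall i j, (i < j)%N -> (s i < s j)%N) -> s = 1%g.
Proof.
move=> s_incr; suff le_s (u : 'S_n) : (forall i j, (i < j)%N -> (u i < u j)%N) ->
    forall i, (i <= u i)%N.
  apply/permP => i; rewrite perm1; apply/val_inj/anti_leq; rewrite le_s// andbT.
  rewrite -{2}(permK s i); apply: (le_s (s^-1)%g) => a b ab.
  rewrite ltnNge; apply/negP; rewrite leq_eqVlt => /predU1P[|/s_incr].
    by move=> /val_inj /perm_inj ba; rewrite ba ltnn in ab.
  by rewrite !permKV ltnNge (ltnW ab).
move=> u_incr [i]; elim: i => //= i IH i1n.
have iN := ltnW i1n.
by apply: leq_ltn_trans (IH iN) _; exact: u_incr.
Qed.

(** In the open chamber the coordinates are distinct and positive, so the order of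
    the absolute values recovers the permutation, and the signs are then forced. *)
Lemma act_interior_inj v w x : (forall i, 0 < wall i (act v x)) ->
  (forall i, 0 < wall i (act w x)) -> v = w.
Proof.
move=> v0 w0.
have chamber_of u : (forall i, 0 < wall i (act u x)) -> @weyl_chamber R n (act u x).
  by move=> u0; apply/weyl_chamberP => i; exact: ltW.
have E := act_chamber_unique (chamber_of _ v0) (chamber_of _ w0).
have norm_lt u i j : (forall i, 0 < wall i (act u x)) ->
    (`|x ord0 (u.1 j)| < `|x ord0 (u.1 i)|) = (i < j)%N.
  move=> u0; rewrite -!(act_chamber_norm (chamber_of _ u0)).
  apply/idP/idP; last exact: wall_gt0_lt.
  apply: contraTT; rewrite -leqNgt -leNgt => ji.
  by have [+ _] := chamber_of _ u0; exact.
have vw1 : (v.1 * w.1^-1)%g = 1%g.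
  apply: increasing_perm_id => i j ij.
  by rewrite -(norm_lt w)// !permM !permKV norm_lt.
move/eqP: vw1; rewrite -eq_mulgV1 => /eqP vw1.
apply: injective_projections => //; apply/ffunP => i.
have := wall_gt0_gt0 i v0; have := wall_gt0_gt0 i w0; rewrite !mxE vw1.
case: (v.2 i); case: (w.2 i) => //; rewrite mul1r mulN1r; lra.
Qed.

End chamber.

(** * Wall reflections and antisymmetrization *)

Section antisymmetrization.
Context {R : realType} (n : nat).
Implicit Types (x y : 'rV[R]_n) (i j : 'I_n) (w : signed_perm n).

Definition l1dist x y : R := \sum_j `|x ord0 j - y ord0 j|.

(** The reflection in wall [i]: exchange coordinates [i] and [i+1], or change the sign
    of the last one. *)
Definition reflection i : signed_perm n :=
  if insub i.+1 is Some j then (tperm i j, [ffun=> false])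
  else (1%g, [ffun k => k == i]).

(** The determinant of [act w]. *)
Definition sgn w : R := (-1) ^+ (w.1 : bool) * \prod_i (-1) ^+ w.2 i.

Lemma actD w x y : act w (x + y) = act w x + act w y.
Proof. by apply/rowP => i; rewrite !mxE mulrDr. Qed.

Lemma act1 x : act (1%g, [ffun=> false]) x = x.
Proof. by apply/rowP => i; rewrite !mxE ffunE perm1 mul1r. Qed.

Lemma reflectionK i x : act (reflection i) (act (reflection i) x) = x.
Proof.
apply/rowP => k; rewrite /reflection; case: insubP => [j _ _|_]; rewrite !mxE /=.
  by rewrite !ffunE !mul1r tpermK.
by rewrite !ffunE !perm1 mulrA -expr2 sqrr_sign mul1r.
Qed.

Lemma l1dist_act w x y : l1dist (act w x) (act w y) = l1dist x y.
Proof.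
rewrite /l1dist [RHS](reindex_inj (@perm_inj _ w.1)); apply: eq_bigr => i _.
by rewrite !mxE -mulrBr normrM normrX normrN1 expr1n mul1r.
Qed.

(** Near a wall a point is close to its mirror image; this is how the values of an
    antisymmetric Lipschitz function near a wall get small. *)
Lemma l1dist_reflection i x : l1dist x (act (reflection i) x) = 2 * `|wall i x|.
Proof.
rewrite /l1dist /reflection /wall; have [i1n|ni1] := ltnP i.+1 n; last first.
  rewrite insubF ?ltnNge ?ni1//= entry_ge// subr0 (bigD1 i)//= big1 => [|j ji].
    by rewrite !mxE ffunE eqxx perm1 mulN1r opprK -mulr2n normrMn addr0 mulr_natl.
  by rewrite !mxE ffunE (negbTE ji) perm1 mul1r subrr normr0.
rewrite insubT/= (entryE x (Ordinal i1n)); set k := Ordinal i1n.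
have ki : k != i by rewrite -val_eqE/= gtn_eqF.
have tE j : act (tperm i k, [ffun=> false]) x ord0 j = x ord0 (tperm i k j).
  by rewrite mxE ffunE mul1r.
rewrite (bigD1 i)//= (bigD1 k)//= big1 => [|j /andP[ji jk]]; last first.
  by rewrite tE tpermD 1?eq_sym// subrr normr0.
by rewrite !tE tpermL tpermR addr0 [X in _ + X]distrC -mulr2n mulr_natl.
Qed.

Definition antisym (f : 'rV[R]_n -> R) x : R := \sum_w sgn w * f (act w x).

(** The product of [w] and [reflection i] in the hyperoctahedral group. *)
Definition compose_reflection i w : signed_perm n :=
  if insub i.+1 is Some j then ((w.1 * tperm i j)%g, w.2)
  else (w.1, [ffun k => w.2 k (+) (w.1 k == i)]).

Lemma compose_reflectionK i : involutive (compose_reflection i).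
Proof.
move=> [s e]; rewrite /compose_reflection; case: insubP => [j _ _|_]/=.
  by rewrite -mulgA tperm2 mulg1.
by congr (_, _); apply/ffunP => k; rewrite !ffunE addbK.
Qed.

Lemma act_compose_reflection i w x :
  act (compose_reflection i w) x = act w (act (reflection i) x).
Proof.
apply/rowP => k; rewrite /compose_reflection /reflection.
case: insubP => [j _ _|_]; rewrite !mxE/= ?ffunE.
  by rewrite permM mul1r.
by rewrite perm1 mulrA signr_addb.
Qed.

Lemma sgn_compose_reflection i w : sgn (compose_reflection i w) = - sgn w.
Proof.
rewrite /sgn /compose_reflection; case: insubP => [j _ ji|_]/=.
  rewrite odd_permM odd_tperm -val_eqE/= ji ltn_eqF// signr_addb mulrN1.
  by rewrite mulNr.
rewrite -mulrN; congr (_ * _).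
under eq_bigr do rewrite ffunE signr_addb.
rewrite big_split/= [X in _ * X](bigD1 ((w.1^-1)%g i))//= [X in _ * (_ *
  X)]big1 => [|k ki].
  by rewrite permKV eqxx mulr1 mulrN1.
by rewrite -(inj_eq (@perm_inj _ (w.1^-1)%g)) permK (negbTE ki).
Qed.

(** Composition with a reflection permutes the group and changes every sign. *)
Lemma antisym_reflection f i x : antisym f (act (reflection i) x) = - antisym f x.
Proof.
rewrite /antisym [in RHS](reindex_inj (can_inj (compose_reflectionK i))).
rewrite -sumrN; apply: eq_bigr => w _.
by rewrite sgn_compose_reflection act_compose_reflection mulNr opprK.
Qed.

Lemma norm_sgn w : `|sgn w| = 1.
Proof.
rewrite /sgn normrM normrX normrN1 expr1n mul1r normr_prod big1// => i _.
by rewrite normrX normrN1 expr1n.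
Qed.

Lemma norm_antisym (f : 'rV[R]_n -> R) (M : R) x : (forall y, `|f y| <= M) ->
  `|antisym f x| <= #|{: signed_perm n}|%:R * M.
Proof.
move=> fM; apply: (le_trans (ler_norm_sum _ _ _)).
rewrite mulr_natl -sumr_const; apply: ler_sum => w _.
by rewrite normrM norm_sgn mul1r.
Qed.

Lemma antisym_lipschitz (f : 'rV[R]_n -> R) (L : R) x y :
  (forall x y, `|f x - f y| <= L * l1dist x y) ->
  `|antisym f x - antisym f y| <= #|{: signed_perm n}|%:R * L * l1dist x y.
Proof.
move=> fL; rewrite /antisym -sumrB; apply: (le_trans (ler_norm_sum _ _ _)).
rewrite -mulrA mulr_natl -sumr_const; apply: ler_sum => w _.
by rewrite -mulrBr normrM norm_sgn mul1r -(l1dist_act w).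
Qed.

Lemma measurable_antisym (f : 'rV[R]_n -> R) :
  measurable_fun setT f -> measurable_fun setT (antisym f).
Proof.
move=> mf; apply: measurable_sum => w; apply: measurable_funM => //.
by apply: measurableT_comp => //; exact: measurable_act.
Qed.

(** Only the identity keeps a point of the open chamber in the open chamber, so all
    other terms vanish. *)
Lemma antisym_interior (f : 'rV[R]_n -> R) x :
  (forall y i, wall i y <= 0 -> f y = 0) ->
  (forall i, 0 < wall i x) -> antisym f x = f x.
Proof.
move=> f0 x0; rewrite /antisym (bigD1 (1%g, [ffun=> false]))//= act1.
rewrite {1}/sgn odd_perm1 mul1r big1 ?mul1r => [|i _]; last by rewrite ffunE.
rewrite big1 ?addr0// => w w1.
have [w0|[i]] : (forall i, 0 < wall i (act w x)) \/ exists i, wall i (act w x) <= 0.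
- have [[i wi]|H] := pselect (exists i, wall i (act w x) <= 0).
    by right; exists i.
  by left => i; rewrite ltNge; apply/negP => wi; apply: H; exists i.
- move/negP: w1; case; apply/eqP; apply: (act_interior_inj w0) => i.
  by rewrite act1.
- by move=> /f0 ->; rewrite mulr0.
Qed.

End antisymmetrization.

(** * Reflecting the last increment of a discretized path *)

Section reflection_coupling.
Context d (Omega : measurableType d) (R : realType) (P : probability Omega R).
Variables (n : nat) (X : R -> {RV P >-> 'rV[R]_n}) (eta : 'rV[R]_n).
Hypothesis BM : standard_brownian_motion eta X.

Lemma measurable_increment s t : measurable_fun setT (fun w => X t w - X s w).
Proof.
apply: measurable_fun_row => i.
rewrite (_ : _ \o _ = (row_coord i \o X t) \- (row_coord i \o X s)).
  by apply: measurable_funB; apply: measurableT_comp => //;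
    exact: measurable_row_coord.
by apply/funext => w; rewrite /row_coord/= !mxE.
Qed.

Lemma act_increment_law (g : signed_perm n) s t (A : set 'rV[R]_n) :
  0 <= s -> s <= t -> measurable A ->
  P ((fun w => act g (X t w - X s w)) @^-1` A) = P ((fun w =>
    X t w - X s w) @^-1` A).
Proof.
(* For s = t the increment is 0, which every signed permutation fixes. *)
move=> s0; rewrite le_eqVlt => /predU1P[<-|st] mA.
  congr (P _); apply/seteqP; split => w /=; rewrite !subrr.
    by congr A; apply/rowP => i; rewrite !mxE mulr0.
  by congr A; apply/rowP => i; rewrite !mxE mulr0.
have [_ _ _ /(_ _ _ s0 st)[ind law]] := BM.
move: A mA; apply: eq_law_boxes.
- by apply: measurableT_comp; [exact: measurable_act|exact: measurable_increment].
- exact: measurable_increment.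
- by move=> B mB; apply: (@gaussian_act_sym _ _ _ _ _ (t - s)) => //;
  rewrite subr_gt0.
Qed.

(** The increments are independent, so on boxes their joint law is a product; only
    the last factor is affected by [g], and its law is invariant under [g]. *)
Lemma increments_reflection (g : signed_perm n) (k : nat) (tau : nat -> R) :
  0 <= tau 0%N -> nondecreasing_seq tau ->
  forall (h : 'rV['rV[R]_n]_k.+1 -> R) (M : R),
  measurable_fun setT h -> (forall y, `|h y| <= M) ->
  \int[P]_w h (\row_j (X (tau j.+1) w - X (tau j) w)) =
  \int[P]_w h (\row_j (if j == ord_max then act g (X (tau j.+1) w - X (tau j) w)
                       else X (tau j.+1) w - X (tau j) w)).
Proof.
move=> tau0 ndtau h M mh hM.
pose xi (j : 'I_k.+1) w := X (tau j.+1) w - X (tau j) w.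
pose xi' (j : 'I_k.+1) w := if j == ord_max then act g (xi j w) else xi j w.
have mxi j : measurable_fun setT (xi j) by exact: measurable_increment.
have mxi' j : measurable_fun setT (xi' j).
  rewrite /xi'; case: (j == ord_max); last exact: mxi.
  by apply: measurableT_comp; [exact: measurable_act|exact: mxi].
have tau_ge0 j : 0 <= tau j by rewrite (le_trans tau0)// ndtau.
have [_ _ ind _] := BM.
apply: (@eq_law_expectation _ _ _ P _ _ (fun w => \row_j xi j w) (fun w =>
  \row_j xi' j w) h M) => //.
- apply: measurable_fun_row => j; rewrite (_ : _ \o _ = xi j)//.
  by apply/funext => w; rewrite /row_coord/= mxE.
- apply: measurable_fun_row => j; rewrite (_ : _ \o _ = xi' j)//.
  by apply/funext => w; rewrite /row_coord/= mxE.
apply: eq_law_boxes.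
- apply: measurable_fun_row => j; rewrite (_ : _ \o _ = xi j)//.
  by apply/funext => w; rewrite /row_coord/= mxE.
- apply: measurable_fun_row => j; rewrite (_ : _ \o _ = xi' j)//.
  by apply/funext => w; rewrite /row_coord/= mxE.
move=> B mB.
pose B' (j : 'I_k.+1) := if j == ord_max then act g @^-1` B j else B j.
have mB' j : measurable (B' j).
  rewrite /B'; case: ifP => _ //.
  by rewrite -[X in measurable X]setTI; exact: measurable_act.
have -> : (fun w => \row_j xi j w) @^-1` box B = [set w | forall j, B j (xi j w)].
  by apply/seteqP; split => w Bw j; have := Bw j; rewrite mxE.
have -> : (fun w => \row_j xi' j w) @^-1` box B = [set w | forall j, B' j (xi j w)].
  apply/seteqP; split => w Bw j; have := Bw j; rewrite mxE /xi' /B'.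
    by case: ifP.
  by case: ifP.
rewrite !(ind k.+1 tau tau0 ndtau)//; apply: eq_bigr => j _.
rewrite /B'; case: ifP => // _.
rewrite -(act_increment_law g (tau_ge0 j) _ (mB j))//.
exact: ndtau.
Qed.

(** This discrete reflection takes the place of the strong Markov property. The
    positions up to [tau k] and the last increment are functions of the row of
    increments, whose law does not change when the last one is moved by [g]. *)
Lemma reflection_coupling (g : signed_perm n) (k : nat) (tau : nat -> R)
    (f : 'rV[R]_n -> R) (c : 'rV['rV[R]_n]_k.+1 -> R) (M M' : R) :
  tau 0%N = 0 -> nondecreasing_seq tau ->
  measurable_fun setT f -> (forall x, `|f x| <= M) ->
  measurable_fun setT c -> (forall z, `|c z| <= M') ->
  \int[P]_w (f (X (tau k.+1) w) * c (\row_j X (tau j) w)) =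
  \int[P]_w (f (X (tau k) w + act g (X (tau k.+1) w - X (tau k) w)) *
             c (\row_j X (tau j) w)).
Proof.
move=> tau0 ndtau mf fM mc cM.
(* Position at time tau_j, recovered from the row of increments. *)
pose pos (y : 'rV['rV[R]_n]_k.+1) (j : nat) :=
  eta + \sum_(l < k.+1 | (l < j)%N) y ord0 l.
have mpos j : measurable_fun setT (pos^~ j).
  apply: measurable_fun_row => i.
  rewrite (_ : _ \o _ = (fun y => eta ord0 i +
      \sum_(l < k.+1) (if (l < j)%N then (row_coord i (row_coord l y :
        'rV[R]_n) : R) else 0))).
    apply: measurable_funD => //; apply: measurable_sum => l; case: (l < j)%N => //.
    by apply: measurableT_comp; exact: measurable_row_coord.
  by apply/funext => y; rewrite /row_coord /pos /= !mxE summxE big_mkcond.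
pose h y := f (pos y k.+1) * c (\row_(j < k.+1) pos y j).
have mh : measurable_fun setT h.
  apply: measurable_funM; first exact: measurableT_comp.
  apply: measurableT_comp => //; apply: measurable_fun_row => j.
  rewrite (_ : _ \o _ = pos^~ j); first exact: mpos.
  by apply/funext => y; rewrite /row_coord/= mxE.
have hM y : `|h y| <= M * M' by rewrite normrM ler_pM.
have X0 w : X (tau 0%N) w = eta by rewrite tau0; have [->] := BM.
have posX (y : 'rV['rV[R]_n]_k.+1) w j : (j <= k.+1)%N ->
    (forall l : 'I_k.+1, (l < j)%N -> y ord0 l = X (tau l.+1) w - X (tau l) w) ->
    pos y j = X (tau j) w.
  elim: j => [_ _|j IH jk yE].
    by rewrite /pos big_pred0 ?addr0// X0.
  have /IH{}IH : (j <= k.+1)%N by exact: ltnW.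
  rewrite -[RHS](subrK (X (tau j) w)) -[Z in _ = _ + Z]IH; last first.
    by move=> l lj; apply: yE; exact: ltnW.
  rewrite /pos (bigD1 (Ordinal jk))//= yE// addrCA; congr (_ + (_ + _)).
  apply: eq_bigl => l; rewrite ltnS [RHS]ltn_neqAle andbC; congr (_ && _).
have := @increments_reflection g k tau _ ndtau h (M * M') mh hM.
rewrite tau0 => /(_ (lexx 0)) E.
transitivity (\int[P]_w h (\row_j (X (tau j.+1) w - X (tau j) w))).
  apply: eq_Rintegral => w _; rewrite /h (posX _ w)//; last first.
    by move=> l _; rewrite mxE.
  congr (_ * c _); apply/rowP => j; rewrite !mxE (posX _ w)//; first exact: ltnW.
  by move=> l _; rewrite mxE.
rewrite E; apply: eq_Rintegral => w _; rewrite /h; set y := \row_j _.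
have yE (l : 'I_k.+1) : (l < k)%N -> y ord0 l = X (tau l.+1) w - X (tau l) w.
  by move=> lk; rewrite mxE -val_eqE/= ltn_eqF.
congr (f _ * c _).
  rewrite -[Z in _ =
    Z + _](posX y w k)// /pos (bigD1 ord_max)//= {1}/y mxE eqxx addrCA addrC.
  congr (_ + _ + _); apply: eq_bigl => l.
  by rewrite [in RHS]ltn_neqAle -[(l <= k)%N]ltnS ltn_ord andbT -val_eqE.
apply/rowP => j; rewrite !mxE (posX _ w)//; first exact: ltnW.
by move=> l lj; apply: yE; apply: leq_trans lj _; rewrite -ltnS.
Qed.

End reflection_coupling.

(** * Exit from the chamber along a grid *)

Section exit_weights.
Context {R : realType}.

(** For [a] with values in {0, 1}, the indicator that [m] is the first index with
    [a m = 1]. *)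
Definition first_hit (a : nat -> R) (m : nat) : R := a m * \prod_(l < m) (1 - a l).

(** There is a first hit before [K] unless there is none at all. *)
Lemma sum_first_hit a K : \sum_(m < K) first_hit a m = 1 - \prod_(l < K) (1 - a l).
Proof.
elim: K => [|K IH]; first by rewrite !big_ord0 subrr.
by rewrite !big_ord_recr /= IH /first_hit; ring.
Qed.

Variable n : nat.
Implicit Types (x : 'rV[R]_n) (i : 'I_n) (eps : R).

(** The indicator that wall [l] is violated at level [eps]. It is indexed by [nat] so
    that the first violated wall can be singled out by [first_hit]. *)
Definition beyond eps x (l : nat) : R :=
  if insub l is Some i then (wall i x < eps)%R%:R else 0.

Definition inside eps x : R := \prod_(l < n) (1 - beyond eps x l).

(** The indicator that [i] is the first wall that [x] violates at level [eps]. *)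
Definition exit_wall eps i x : R := first_hit (beyond eps x) i.

Lemma beyondE eps x i : beyond eps x i = (wall i x < eps)%R%:R.
Proof. by rewrite /beyond insubT //= => ?; congr ((wall _ _ < _)%R%:R);
  exact: val_inj. Qed.

Lemma beyond01 eps x l : 0 <= beyond eps x l <= 1.
Proof. by rewrite /beyond; case: insubP => [i _ _|_];
  rewrite ?lexx ?ler01// ler0n lern1 leq_b1. Qed.

Lemma prod_onem01 (a : nat -> R) m : (forall l, 0 <= a l <= 1) ->
  0 <= \prod_(l < m) (1 - a l) <= 1.
Proof.
move=> a01; apply/andP; split.
  by apply: prodr_ge0 => l _; have /andP[] := a01 l; rewrite subr_ge0.
apply: prodr_ile1 => l _; have /andP[a0 a1] := a01 l.
by rewrite subr_ge0 a1 gerBl.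
Qed.

Lemma insideE eps x : inside eps x = [forall i, (eps <= wall i x)%R]%:R.
Proof.
rewrite /inside; have [/forallP h|/forallPn[i]] :=
  boolP [forall i, (eps <= wall i x)%R].
  by rewrite big1// => i _; rewrite beyondE ltNge h subr0.
by rewrite -ltNge => wi; rewrite (bigD1 i)//= beyondE wi subrr mul0r.
Qed.

Lemma inside01 eps x : 0 <= inside eps x <= 1.
Proof. by rewrite insideE ler0n lern1 leq_b1. Qed.

Lemma exit_wall01 eps i x : 0 <= exit_wall eps i x <= 1.
Proof.
have /andP[b0 b1] := beyond01 eps x i.
have /andP[p0 p1] := prod_onem01 i (beyond01 eps x).
by rewrite mulr_ge0//= mulr_ile1.
Qed.

Lemma exit_wall_neq0 eps i x : exit_wall eps i x != 0 -> wall i x < eps.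
Proof.
rewrite /exit_wall /first_hit beyondE; case: (_ < _) => //.
by rewrite mul0r eqxx.
Qed.

Lemma sum_exit_wall eps x : \sum_i exit_wall eps i x = 1 - inside eps x.
Proof. by rewrite /exit_wall (sum_first_hit (beyond eps x)). Qed.

Lemma measurable_fun_natr_bool d (T : measurableType d) (p : T -> bool) :
  measurable_fun setT p -> measurable_fun setT (fun u => (p u)%:R : R).
Proof.
move=> mp; rewrite (_ : (fun _ => _) = (fun u => if p u then 1 else 0)).
  exact: measurable_fun_ifT.
by apply/funext => u; case: (p u).
Qed.

Lemma measurable_beyond eps l : measurable_fun setT (beyond eps ^~ l).
Proof.
rewrite /beyond; case: insubP => [i _ _|_] //.
apply: measurable_fun_natr_bool; apply: measurable_fun_ltr => //.
exact: measurable_wall.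
Qed.

Lemma measurable_inside eps : measurable_fun setT (inside eps).
Proof.
apply: measurable_prod => l _; apply: measurable_funB => //.
exact: measurable_beyond.
Qed.

Lemma measurable_exit_wall eps i : measurable_fun setT (exit_wall eps i).
Proof.
apply: measurable_funM; first exact: measurable_beyond.
apply: measurable_prod => l _; apply: measurable_funB => //.
exact: measurable_beyond.
Qed.

(** The indicator that a discrete path is inside at level [eps] before step [k] and
    violates wall [i] first at step [k]. *)
Definition exit_weight eps (k : nat) i (z : 'rV['rV[R]_n]_k.+1) : R :=
  \prod_(l < k) inside eps (z ord0 (inord l)) * exit_wall eps i (z ord0 ord_max).

Lemma measurable_exit_weight eps k i : measurable_fun setT (@exit_weight eps k i).
Proof.
apply: measurable_funM; last first.
  apply: (measurableT_comp (measurable_exit_wall eps i)).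
  exact: measurable_row_coord.
apply: measurable_prod => l _; apply: (measurableT_comp (measurable_inside eps)).
exact: (measurable_row_coord (inord l)).
Qed.

Lemma exit_weight01 eps k i z : 0 <= @exit_weight eps k i z <= 1.
Proof.
have /andP[e0 e1] := exit_wall01 eps i (z ord0 ord_max).
have p0 : 0 <= \prod_(l < k) inside eps (z ord0 (inord l)).
  by apply: prodr_ge0 => l _; have /andP[] := inside01 eps (z ord0 (inord l)).
have p1 : \prod_(l < k) inside eps (z ord0 (inord l)) <= 1.
  by apply: prodr_ile1 => l _; exact: inside01.
by rewrite mulr_ge0//= mulr_ile1.
Qed.

(** The pairs (exit step, violated wall) partition the event of an exit. *)
Lemma sum_exit_weight eps (z : nat -> 'rV[R]_n) K :
  \sum_(k < K) \sum_i exit_weight eps i (\row_(j < k.+1) z j) =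
  1 - \prod_(k < K) inside eps (z k).
Proof.
pose a k := 1 - inside eps (z k).
transitivity (\sum_(k < K) first_hit a k); last first.
  by rewrite sum_first_hit; congr (1 - _); apply: eq_bigr => k _; rewrite /a subKr.
apply: eq_bigr => k _; rewrite /exit_weight -mulr_sumr.
rewrite mxE sum_exit_wall mulrC; congr (_ * _); apply: eq_bigr => l _.
by rewrite mxE inordK ?subKr// ltnS ltnW.
Qed.

End exit_weights.

Section exit_estimate.
Context d (Omega : measurableType d) (R : realType) (P : probability Omega R).
Variables (n : nat) (X : R -> {RV P >-> 'rV[R]_n}) (eta : 'rV[R]_n).
Hypothesis BM : standard_brownian_motion eta X.
Variables (F : 'rV[R]_n -> R) (M L : R).
Hypotheses (mF : measurable_fun setT F) (FM : forall x, `|F x| <= M)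
  (L0 : 0 <= L) (FL : forall x y, `|F x - F y| <= L * l1dist x y)
  (FN : forall i x, F (act (reflection i) x) = - F x).

Let measurable_X_row (tau : nat -> R) k :
  measurable_fun setT (fun w => \row_(j < k) X (tau j) w).
Proof.
apply: measurable_fun_row => j; rewrite (_ : _ \o _ = X (tau j))//.
by apply/funext => w; rewrite /row_coord/= mxE.
Qed.

(** Write the expectation in its original and in its reflected form and average the
    two. As [F] changes sign under the reflection, the average compares [F] at two
    points whose distance is that of [X (tau k)] to its mirror image. *)
Lemma reflection_estimate i k (tau : nat -> R) (c : 'rV['rV[R]_n]_k.+1 -> R)
    (D : Omega -> R) :
  tau 0%N = 0 -> nondecreasing_seq tau ->
  measurable_fun setT c -> (forall z, 0 <= c z <= 1) ->
  P.-integrable setT (EFin \o D) ->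
  (forall w, Num.min M (L * `|wall i (X (tau k) w)|) * c (\row_j X (tau j) w)
    <= D w) ->
  `|\int[P]_w (F (X (tau k.+1) w) * c (\row_j X (tau j) w))| <= \int[P]_w D w.
Proof.
move=> tau0 ndtau mc c01 iD hD.
have c1 z : `|c z| <= 1 by have /andP[c0 ?] := c01 z; rewrite ger0_norm.
have E := reflection_coupling BM (reflection i) tau0 ndtau mF FM mc c1.
set I := Rintegral _ _ _ in E *; set I' := Rintegral _ _ _ in E.
have ib (Y : Omega -> 'rV[R]_n) : measurable_fun setT Y ->
    P.-integrable setT (EFin \o (fun w => F (Y w) * c (\row_j X (tau j) w))).
  move=> mY; apply: (@integrable_bounded _ _ _ _ _ (M * 1)).
    apply: measurable_funM; first exact: (measurableT_comp mF mY).
    exact: (measurableT_comp mc (@measurable_X_row tau k.+1)).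
  by move=> w; rewrite normrM ler_pM.
have mr : measurable_fun setT
    (fun w => X (tau k) w + act (reflection i) (X (tau k.+1) w - X (tau k) w)).
  apply: measurable_row_add => //.
  by apply: measurableT_comp; [exact: measurable_act|exact: measurable_increment].
(* I' is the reflected form of the expectation I, and is equal to it. *)
have I2 : 2 * I = I + I' by rewrite -E; ring.
have -> : `|I| = 2^-1 * `|2 * I| by rewrite normrM (@ger0_norm _ 2)// mulKf.
rewrite ler_pdivrMl// I2 -RintegralD//; [|exact: ib..].
set S := fun w : Omega => _ + _.
have iS : P.-integrable setT (EFin \o S).
  rewrite (_ : _ \o _ = (fun w => (F (X (tau k.+1) w) * c (\row_j X (tau j) w))%:E +
     (F (X (tau k) w + act (reflection i) (X (tau k.+1) w - X (tau k) w)) *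
       c (\row_j X (tau j) w))%:E)%E) //.
  by apply: integrableD => //; [exact: (ib (X (tau k.+1)))|exact: (ib _ mr)].
apply: (le_trans (le_normr_Rintegral measurableT iS)).
rewrite -RintegralZl//; apply: le_Rintegral => //.
- exact: integrable_norm.
- by rewrite (_ : _ \o _ = (fun w => 2%:E * (D w)%:E)%E)//; exact: integrableZl.
move=> w _; apply: (@le_trans _ _ (2 * (Num.min M (L * `|wall i (X (tau k) w)|) *
  c (\row_j X (tau j) w)))); last by rewrite ler_pM2l.
rewrite /S -mulrDl normrM mulrA.
have /andP[c0 _] := c01 (\row_j X (tau j) w).
rewrite (ger0_norm c0) ler_wpM2r//.
set x := X (tau k) w; set y := X (tau k.+1) w.
have -> : F (x + act (reflection i) (y - x)) =
    - F (act (reflection i) x + (y - x)).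
  by rewrite -(FN i) [in RHS]actD reflectionK.
have -> : 2 * Num.min M (L * `|wall i x|) = Num.min (M + M) (L * (2 * `|wall i x|)).
  by rewrite minr_pMr// mulr_natl -mulr2n; congr Num.min; ring.
rewrite le_min; apply/andP; split.
  by apply: (le_trans (ler_normB _ _)); exact: lerD.
apply: (le_trans (FL _ _)); rewrite ler_wpM2l// -l1dist_reflection.
apply: ler_sum => j _; rewrite !mxE le_eqVlt; apply/orP; left; apply/eqP.
by congr `|_|; ring.
Qed.

Section grid.
Variables (t eps : R) (N : nat).
Hypotheses (t0 : 0 < t) (N0 : (0 < N)%N) (eps0 : 0 < eps)
  (eta_eps : forall i, eps <= wall i eta).

Definition grid (T : R) (K : nat) (l : nat) : R := l%:R * T / K%:R.

(** The indicator that no root changes by more than [eps] in one step of the grid. *)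
Definition small_steps w : R :=
  \prod_(l < N) \prod_i
    (`|wall i (X (grid t N l.+1) w) - wall i (X (grid t N l) w)| <= eps)%R%:R.

Lemma measurable_small_steps : measurable_fun setT small_steps.
Proof.
apply: measurable_prod => l _; apply: measurable_prod => i _.
apply: measurable_fun_natr_bool; apply: measurable_fun_ler => //.
apply: measurableT_comp => //; apply: measurable_funB;
  apply: measurableT_comp => //; exact: measurable_wall.
Qed.

Lemma small_stepsE w : small_steps w = [forall l : 'I_N, forall i : 'I_n,
    (`|wall i (X (grid t N l.+1) w) - wall i (X (grid t N l) w)| <= eps)%R]%:R.
Proof.
rewrite /small_steps; have [/forallP h|/forallPn[l /forallPn[i]]] :=
    boolP [forall l : 'I_N, forall i : 'I_n,
    (`|wall i (X (grid t N l.+1) w) - wall i (X (grid t N l) w)| <= eps)%R].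
  by rewrite big1// => l _; rewrite big1// => i _; have /forallP/(_ i) -> := h l.
by move=> /negbTE li; rewrite (bigD1 l)//= (bigD1 i)//= li !mul0r.
Qed.

Let grid0 : grid t N 0 = 0.
Proof. by rewrite /grid !mul0r. Qed.

Let gridN : grid t N N = t.
Proof. by rewrite /grid mulrAC divff ?mul1r// pnatr_eq0 -lt0n. Qed.

Let grid_le l m : (l <= m)%N -> grid t N l <= grid t N m.
Proof.
by move=> lm; rewrite /grid ler_wpM2r ?invr_ge0// ler_wpM2r ?(ltW t0)// ler_nat.
Qed.

(* The grid up to the exit step, followed by the final time. *)
Let stopped_grid (k j : nat) : R := if (j <= k)%N then grid t N j else t.

Let stopped_grid_nd k : (k <= N)%N -> nondecreasing_seq (stopped_grid k).
Proof.
move=> kN i j ij; rewrite /stopped_grid.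
have [jk|kj] := leqP j k; first by rewrite (leq_trans ij jk) grid_le.
case: leqP => // ik; rewrite -[leRHS]gridN grid_le//.
exact: leq_trans kN.
Qed.

Let small_steps01 w : 0 <= small_steps w <= 1.
Proof. by rewrite small_stepsE ler0n lern1 leq_b1. Qed.

Let M0 : 0 <= M.
Proof. exact: le_trans (normr_ge0 _) (FM 0). Qed.

(** When the steps are small, the root violated at the exit step was at least [eps]
    one step earlier, hence lies between 0 and [eps]; otherwise the bound [M] is used. *)
Let exit_bound (k : 'I_N.+1) i w :
  Num.min M (L * `|wall i (X (grid t N k) w)|) *
    exit_weight eps i (\row_(j < k.+1) X (grid t N j) w) <=
  (L * eps + M * (1 - small_steps w)) *
    exit_weight eps i (\row_(j < k.+1) X (grid t N j) w).
Proof.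
set c := exit_weight _ _ _.
have [->|c0] := eqVneq c 0; first by rewrite !mulr0.
have /andP[c_ge0 _] : 0 <= c <= 1 by exact: exit_weight01.
rewrite ler_wpM2r//.
move: c0; rewrite /c /exit_weight mulf_eq0 negb_or => /andP[p0 /exit_wall_neq0].
rewrite mxE /= => wk.
rewrite small_stepsE; have [/forallP h|_] :=
  boolP [forall l : 'I_N, forall i : 'I_n,
    (`|wall i (X (grid t N l.+1) w) - wall i (X (grid t N l) w)| <= eps)%R];
      last first.
  by rewrite subr0 mulr1 ge_min lerDr mulr_ge0// ltW.
rewrite subrr mulr0 addr0 ge_min; apply/orP; right; rewrite ler_wpM2l//.
rewrite ler_norml (ltW wk) andbT.
case: k c c_ge0 p0 wk => -[|k] kN /= _ _ p0 wk.
  have [X0 _ _ _] := BM.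
  by move: wk; rewrite grid0 X0 ltNge eta_eps.
have wk1 : eps <= wall i (X (grid t N k) w).
  move: p0; rewrite big_ord_recr/= mulf_eq0 negb_or => /andP[_].
  rewrite mxE insideE inordK ?ltnS//; case: forallP => [/(_ i) //|_].
  by rewrite eqxx.
have kN' : (k < N)%N by [].
have /forallP/(_ i) := h (Ordinal kN'); rewrite ler_norml => /andP[+ _] /=.
lra.
Qed.

(** Split the complement of the event of staying inside according to the exit step
    and the violated wall, and apply the reflection estimate to each part. *)
Lemma exit_estimate :
  `|\int[P]_w F (X t w) -
    \int[P]_w (F (X t w) * \prod_(l < N.+1) inside eps (X (grid t N l) w))| <=
  L * eps + M * (1 - \int[P]_w small_steps w).
Proof.
pose z w l := X (grid t N l) w.
pose c (k : 'I_N.+1) i w := exit_weight eps i (\row_(j < k.+1) z w j).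
have mc k i : measurable_fun setT (c k i).
  exact: (measurableT_comp (@measurable_exit_weight R n eps k i)
    (@measurable_X_row (grid t N) k.+1)).
have c01 k i w : 0 <= c k i w <= 1 by exact: exit_weight01.
have mFX : measurable_fun setT (fun w => F (X t w)) by exact: measurableT_comp.
have iFc k i : P.-integrable setT (EFin \o (fun w => F (X t w) * c k i w)).
  apply: (@integrable_bounded _ _ _ _ _ (M * 1)); first exact: measurable_funM.
  move=> w; have /andP[c0 c1] := c01 k i w.
  by rewrite normrM ler_pM// ger0_norm.
pose D0 w := L * eps + M * (1 - small_steps w).
have mD0 : measurable_fun setT D0.
  apply: measurable_funD => //; apply: measurable_funM => //.
  by apply: measurable_funB => //; exact: measurable_small_steps.
have D0_ge0 w : 0 <= D0 w.
  have /andP[s0 s1] := small_steps01 w.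
  by rewrite addr_ge0// mulr_ge0// ?subr_ge0// ltW.
have D0_le w : `|D0 w| <= L * eps + M.
  have /andP[s0 s1] := small_steps01 w.
  by rewrite ger0_norm// lerD2l ler_piMr// gerBl.
have iD k i : P.-integrable setT (EFin \o (fun w => D0 w * c k i w)).
  apply: (@integrable_bounded _ _ _ _ _ ((L * eps + M) * 1)).
    exact: measurable_funM.
  move=> w; have /andP[c0 c1] := c01 k i w.
  by rewrite normrM ler_pM// ger0_norm.
have sumc w : \sum_(k < N.+1) \sum_i c k i w =
    1 - \prod_(l < N.+1) inside eps (z w l) by exact: sum_exit_weight.
have iP : P.-integrable setT
    (EFin \o (fun w => F (X t w) * \prod_(l < N.+1) inside eps (z w l))).
  apply: (@integrable_bounded _ _ _ _ _ (M * 1)).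
    apply: measurable_funM => //; apply: measurable_prod => l _.
    by apply: (measurableT_comp (measurable_inside eps)).
  move=> w; rewrite normrM ler_pM// ger0_norm.
    by apply: prodr_ile1 => l _; exact: inside01.
  by apply: prodr_ge0 => l _; have /andP[] := inside01 eps (z w l).
have iF : P.-integrable setT (EFin \o (fun w => F (X t w))).
  by apply: (@integrable_bounded _ _ _ _ _ M).
rewrite -RintegralB//.
have -> : \int[P]_w (F (X t w) - F (X t w) * \prod_(l < N.+1) inside eps (z w l)) =
    \sum_(k < N.+1) \sum_i \int[P]_w (F (X t w) * c k i w).
  under [RHS]eq_bigr do rewrite -Rintegral_sum//.
  rewrite -Rintegral_sum.
    apply: eq_Rintegral => w _; under [RHS]eq_bigr do rewrite -mulr_sumr.
    by rewrite -[RHS]mulr_sumr sumc mulrBr mulr1.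
  move=> k; rewrite (_ : _ \o _ = (fun w => \sum_i (F (X t w) * c k i w)%:E)%E).
    by apply: integrable_sum => // i _; exact: iFc.
  by apply/funext => w; rewrite /= sumEFin.
have est (k : 'I_N.+1) i :
    `|\int[P]_w (F (X t w) * c k i w)| <= \int[P]_w (D0 w * c k i w).
  have kN : (k <= N)%N by rewrite -ltnS.
  have sE w : \row_(j < k.+1) X (stopped_grid k j) w = \row_(j < k.+1) z w j.
    by apply/rowP => j; rewrite !mxE /stopped_grid -ltnS ltn_ord.
  have -> : \int[P]_w (F (X t w) * c k i w) =
      \int[P]_w (F (X (stopped_grid k k.+1) w) *
        exit_weight eps i (\row_(j < k.+1) X (stopped_grid k j) w)).
    by apply: eq_Rintegral => w _; rewrite sE /stopped_grid ltnn.
  apply: (@reflection_estimate i).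
  - by rewrite /stopped_grid leq0n grid0.
  - exact: stopped_grid_nd.
  - exact: measurable_exit_weight.
  - by move=> y; exact: exit_weight01.
  - exact: iD.
  - by move=> w; rewrite sE /stopped_grid leqnn; exact: exit_bound.
apply: (le_trans (ler_norm_sum _ _ _)).
apply: (@le_trans _ _ (\sum_(k < N.+1) \sum_i \int[P]_w (D0 w * c k i w))).
  apply: ler_sum => k _; apply: (le_trans (ler_norm_sum _ _ _)).
  by apply: ler_sum => i _; exact: est.
under eq_bigr do rewrite -Rintegral_sum//.
rewrite -Rintegral_sum; last first.
  move=> k; rewrite (_ : _ \o _ = (fun w => \sum_i (D0 w * c k i w)%:E)%E).
    by apply: integrable_sum => // i _; exact: iD.
  by apply/funext => w; rewrite /= sumEFin.
have iD0 : P.-integrable setT (EFin \o D0) 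
  by apply: (@integrable_bounded _ _ _ _ _ (L * eps + M)).
have -> : L * eps + M * (1 - \int[P]_w small_steps w) = \int[P]_w D0 w.
  have iss : P.-integrable setT (EFin \o small_steps).
    apply: (@integrable_bounded _ _ _ _ _ 1); first exact: measurable_small_steps.
    by move=> w; have /andP[s0 s1] := small_steps01 w; rewrite ger0_norm.
  have ic (r : R) : P.-integrable setT (EFin \o (fun=> r)).
    by apply: (@integrable_bounded _ _ _ _ _ `|r|).
  have cE (r : R) : \int[P]_w r = r.
    transitivity (r * fine (P setT)); first exact: Rintegral_cst.
    by rewrite probability_setT mulr1.
  have ism : P.-integrable setT (EFin \o (fun w => 1 - small_steps w)).
    by rewrite (_ : _ \o _ = (fun w => 1%:E - (small_steps w)%:E)%E)//;
      exact: (integrableB measurableT (ic 1) iss).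
  rewrite RintegralD//; last first.
    rewrite (_ : _ \o _ = (fun w => M%:E * (1 - small_steps w)%:E)%E)//.
    exact: integrableZl.
  by rewrite cE RintegralZl// RintegralB// cE.
apply: le_Rintegral => //.
  rewrite (_ : _ \o _ = (fun w =>
    \sum_(k < N.+1) (\sum_i (D0 w * c k i w))%:E)%E); last first.
    by apply/funext => w; rewrite /= sumEFin.
  apply: integrable_sum => // k _.
  rewrite (_ : (fun w => _) = (fun w => \sum_i (D0 w * c k i w)%:E)%E).
    by apply: integrable_sum => // i _; exact: iD.
  by apply/funext => w; rewrite /= sumEFin.
move=> w _; under eq_bigr do rewrite -mulr_sumr.
rewrite -mulr_sumr sumc ler_piMr// gerBl.
by apply: prodr_ge0 => l _; have /andP[] := inside01 eps (z w l).
Qed.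

End grid.

End exit_estimate.

(** * From the grid to continuous time *)

Section real_paths.
Context {R : realType}.
Variables (t : R) (g : R -> R).
Hypotheses (t0 : 0 < t) (cg : {within `[0, t], continuous g}).

(** Uniform continuity on a compact interval, deduced from its covering property. *)
Lemma grid_modulus (e : R) : 0 < e ->
  \forall N \near \oo, forall s s', 0 <= s <= t -> 0 <= s' <= t ->
    `|s' - s| <= t / N%:R -> `|g s' - g s| <= e.
Proof.
move=> e0; pose Q (N : nat) (s : R) := 0 <= s <= t -> forall s', 0 <= s' <= t ->
  `|s' - s| <= t / N%:R -> `|g s' - g s| <= e.
have : \forall N \near \oo, `[0, t]%classic `<=` Q N.
  apply: (compact_near_coveringP _).1 (@segment_compact R 0 t) _ _ _ _ _ => x xt.
  have /(_ x xt)/cvgrPdist_lt/(_ (e / 2)) := (subspace_continuousP _ _).1 cg.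
  rewrite divr_gt0// => /(_ isT)/nbhs_ballP[dl /= dl0 xdl].
  (* Half of the radius is for s near x, the other half for the step t / N. *)
  exists (ball x (dl / 2), [set N | 2 * t / dl < N%:R]) => /=.
    split; first by apply: nbhsx_ballx; rewrite divr_gt0.
    exact: nbhs_infty_gtr.
  move=> [s N] /= [xs tN] st s' s't ss'.
  have N0 : 0 < N%:R :> R by apply: le_lt_trans tN; rewrite divr_ge0 ?mulr_ge0 ?ltW.
  have tNd : t / N%:R < dl / 2.
    by rewrite ltr_pdivrMr// mulrC -ltr_pdivrMr ?divr_gt0// invf_div mulrA [t *
      2]mulrC.
  have hs : `|g x - g s| < e / 2.
    apply: xdl; last by rewrite /= in_itv.
    by apply: le_ball xs; rewrite ler_pdivrMr// ler_pMr// ler1n.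
  have hs' : `|g x - g s'| < e / 2.
    apply: xdl; last by rewrite /= in_itv.
    move: xs; rewrite /ball /= => xs.
    rewrite (_ : x - s' = (x - s) - (s' - s)); last by ring.
    apply: (le_lt_trans (ler_normB _ _)).
    by rewrite [ltRHS](splitr dl) ltrD// (le_lt_trans ss').
  rewrite (_ : g s' - g s = (g x - g s) - (g x - g s')); last by ring.
  apply: (le_trans (ler_normB _ _)).
  by rewrite [leRHS](splitr e) lerD// ltW.
apply: filterS => N H s s' st; exact: (H s).
Qed.

Lemma grid_approx (s : R) (N : nat) : (0 < N)%N -> 0 <= s <= t ->
  exists2 l : nat, (l <= N)%N & `|s - grid t N l| <= t / N%:R.
Proof.
move=> N0 /andP[s0 st]; have NR0 : 0 < N%:R :> R by rewrite ltr0n.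
have q0 : 0 <= s * N%:R / t by rewrite divr_ge0 ?mulr_ge0 ?(ltW t0).
have /andP[l1 l2] := truncn_itv q0.
(* The last grid point before s. *)
exists (Num.truncn (s * N%:R / t)).
  rewrite -(ler_nat R); apply: (le_trans l1).
  by rewrite ler_pdivrMr// mulrC ler_pM2l.
move: l1 l2; rewrite ler_pdivlMr// ltr_pdivrMr// /grid => l1 l2.
have sl : (Num.truncn (s * N%:R / t))%:R * t / N%:R <= s by rewrite ler_pdivrMr.
rewrite ger0_norm ?subr_ge0// lerBlDr -mulrDl ler_pdivlMr//.
by rewrite (le_trans (ltW l2))// -natr1 mulrDl mul1r addrC.
Qed.

Lemma grid_itv (N l : nat) : (0 < N)%N -> (l <= N)%N -> 0 <= grid t N l <= t.
Proof.
move=> N0 lN; rewrite /grid divr_ge0 ?mulr_ge0 ?(ltW t0)//=.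
by rewrite ler_pdivrMr ?ltr0n// mulrC ler_pM2l// ler_nat.
Qed.

End real_paths.

Section survival.
Context d (Omega : measurableType d) (R : realType) (P : probability Omega R).
Variables (n : nat) (X : R -> {RV P >-> 'rV[R]_n}) (eta : 'rV[R]_n) (t : R).
Hypotheses (BM : standard_brownian_motion eta X) (t0 : 0 < t).

Definition stays (eps : R) (w : Omega) : Prop :=
  forall s, 0 <= s <= t -> forall i, eps <= wall i (X s w).

Definition survives (w : Omega) : Prop :=
  forall s, 0 <= s <= t -> forall i, 0 < wall i (X s w).

Lemma wall_path_continuous w i :
  {within `[0, t], continuous (fun s => wall i (X s w))}.
Proof.
have [_ cX _ _] := BM.
have sub : `[0, t]%classic `<=` `[0, +oo[%classic.
  by move=> s; rewrite /= !in_itv/= andbT => /andP[].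
apply: (@within_continuous_comp _ _ _ _ (fun s => X s w) (wall i)).
  by move=> x _; exact: wall_continuous.
exact: continuous_subspaceW sub (cX w).
Qed.

(** Paths are uniformly continuous on the time interval. *)
Lemma small_steps_near eps w : 0 < eps ->
  \forall N \near \oo, small_steps X t eps N w = 1.
Proof.
move=> eps0; have H : \forall N \near \oo, forall i s s', 0 <= s <= t ->
    0 <= s' <= t -> `|s' - s| <= t / N%:R ->
    `|wall i (X s' w) - wall i (X s w)| <= eps.
  by apply: filter_forall => i;
    exact: (grid_modulus t0 (@wall_path_continuous w i) eps0).
apply: filterS2 H (nbhs_infty_gt 0) => N H N0; rewrite small_stepsE.
have -> // : [forall l : 'I_N, forall i : 'I_n,
  (`|wall i (X (grid t N l.+1) w) - wall i (X (grid t N l) w)| <= eps)%R].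
apply/forallP => l; apply/forallP => i; apply: H => //.
- by apply: grid_itv => //; exact: ltnW.
- exact: grid_itv.
- rewrite /grid -mulrBl -mulrBl -natrB// subSnn mul1r ger0_norm//.
  by rewrite divr_ge0// ltW.
Qed.

(** A root that drops strictly below [eps] at some time does so at nearby times of
    every fine enough grid. *)
Lemma inside_grid_near eps w :
  \forall N \near \oo, \prod_(l < N.+1) inside eps (X (grid t N l) w) =
    (`[< stays eps w >])%:R.
Proof.
have [st|nst] := asboolP (stays eps w).
  near=> N; have N0 : (0 < N)%N by near: N; exact: nbhs_infty_gt.
  rewrite big1// => l _; rewrite insideE.
  have -> // : [forall i, (eps <= wall i (X (grid t N l) w))%R].
  by apply/forallP => i; apply: st; apply: grid_itv; rewrite // -ltnS.
have [s [st [i wi]]] : exists s, 0 <= s <= t /\ exists i, wall i (X s w) < eps.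
  apply/not_existsP => H; apply: nst => s st i; rewrite leNgt; apply/negP => wi.
  by apply: (H s); split => //; exists i.
(* Half of the gap below eps is left once s is moved to the grid. *)
have e0 : 0 < (eps - wall i (X s w)) / 2 by rewrite divr_gt0// subr_gt0.
have H := grid_modulus t0 (@wall_path_continuous w i) e0.
apply: filterS2 H (nbhs_infty_gt 0) => N H N0.
have [l lN sl] := grid_approx t0 N0 st.
have : `|wall i (X (grid t N l) w) - wall i (X s w)| <= (eps - wall i (X s w)) / 2.
  by apply: H => //; [exact: grid_itv|rewrite distrC].
rewrite ler_norml => /andP[_ wl].
have wl' : wall i (X (grid t N l) w) < eps by lra.
rewrite (bigD1 (Ordinal (lN : (l < N.+1)%N)))//= insideE.
case: forallP => [/(_ i)|_]; last by rewrite mul0r.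
by rewrite leNgt wl'.
Unshelve. all: by end_near. Qed.

(** On a path that survives, each root attains a positive minimum up to time [t]. *)
Lemma stays_near w :
  \forall m \near \oo, (`[< stays (m.+1%:R^-1) w >])%:R =
    (`[< survives w >])%:R :> R.
Proof.
have [st|nst] := asboolP (survives w); last first.
  near=> m; case: asboolP => // st; exfalso; apply: nst => s /st sm i.
  by apply: lt_le_trans (sm i); rewrite invr_gt0.
have H i : \forall m \near \oo, forall s, 0 <= s <= t -> m.+1%:R^-1 <= wall i
  (X s w).
  have [c ct cmin] := EVT_min (ltW t0) (@wall_path_continuous w i).
  have c0 : 0 < wall i (X c w) by apply: st; move: ct; rewrite in_itv.
  near=> m => s s0t; apply: (@le_trans _ _ (wall i (X c w))); last first.
    by apply: cmin; rewrite in_itv.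
  rewrite invf_ple ?posrE// -natr1 ler_wpDr//.
  by near: m; exact: nbhs_infty_ger.
have {}H : \forall m \near \oo, forall i s, 0 <= s <= t -> m.+1%:R^-1 <= wall i
  (X s w).
  exact: filter_forall.
apply: filterS H => m H; case: asboolP => // nst; exfalso; apply: nst => s s0t i.
exact: H.
Unshelve. all: by end_near. Qed.

Lemma measurable_stays eps : measurable_fun setT (fun w =>
  (`[< stays eps w >])%:R : R).
Proof.
apply: (@measurable_fun_cvg _ _ _ _ (fun N w =>
  \prod_(l < N.+1) inside eps (X (grid t N l) w))).
  move=> N; apply: measurable_prod => l _.
  by apply: (measurableT_comp (measurable_inside eps)).
by move=> w _; apply: eventually_cvg; exact: inside_grid_near.
Qed.

Lemma measurable_survives : measurable_fun setT (fun w =>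
  (`[< survives w >])%:R : R).
Proof.
apply: (@measurable_fun_cvg _ _ _ _ (fun m w => (`[< stays (m.+1%:R^-1) w >])%:R)).
  by move=> m; exact: measurable_stays.
by move=> w _; apply: eventually_cvg; exact: stays_near.
Qed.

Variables (F : 'rV[R]_n -> R) (M L : R).
Hypotheses (mF : measurable_fun setT F) (FM : forall x, `|F x| <= M)
  (L0 : 0 <= L) (FL : forall x y, `|F x - F y| <= L * l1dist x y)
  (FN : forall i x, F (act (reflection i) x) = - F x).
Hypothesis eta0 : forall i, 0 < wall i eta.

Let mFX : measurable_fun setT (fun w => F (X t w)).
Proof. exact: measurableT_comp. Qed.

Let M0 : 0 <= M.
Proof. exact: le_trans (normr_ge0 _) (FM 0). Qed.

Let norm_mul01 (a b : R) : `|a| <= M -> 0 <= b <= 1 -> `|a * b| <= M.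
Proof.
by move=> aM /andP[b0 b1]; rewrite normrM (ger0_norm b0) -[M]mulr1 ler_pM.
Qed.

Let icst (r : R) : P.-integrable setT (EFin \o cst r).
Proof. by apply: (@integrable_bounded _ _ _ _ _ `|r|). Qed.

(** The limit of the exit estimate along ever finer grids, at a fixed level [eps]. *)
Lemma stays_estimate eps : 0 < eps -> (forall i, eps <= wall i eta) ->
  `|\int[P]_w F (X t w) - \int[P]_w (F (X t w) * (`[< stays eps w >])%:R)| <= L
    * eps.
Proof.
move=> eps0 eta_eps.
have inside_prod01 N w : 0 <= \prod_(l < N.+1) inside eps (X (grid t N l) w) <= 1.
  apply/andP; split.
    by apply: prodr_ge0 => l _; have /andP[] := inside01 eps (X (grid t N l) w).
  by apply: prodr_ile1 => l _; exact: inside01.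
have c1 : \int[P]_w (F (X t w) * \prod_(l < N.+1) inside eps (X (grid t N l) w))
    @[N --> \oo] --> \int[P]_w (F (X t w) * (`[< stays eps w >])%:R).
  apply: (@cvg_Rintegral_eventually _ _ _ P _ _ (cst M)) => //.
  - move=> N; apply: measurable_funM => //; apply: measurable_prod => l _.
    by apply: (measurableT_comp (measurable_inside eps)).
  - by move=> N w; exact: norm_mul01.
  - by move=> w; apply: filterS (inside_grid_near eps w) => N ->.
(* The exceptional event of a large step disappears in the limit. *)
have c2 : \int[P]_w small_steps X t eps N w @[N --> \oo] --> \int[P]_w (1 : R).
  apply: (@cvg_Rintegral_eventually _ _ _ P _ _ (cst 1)) => //.
  - by move=> N; exact: measurable_small_steps.
  - move=> N w; rewrite small_stepsE ger0_norm// lern1 leq_b1//.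
  - by move=> w; exact: small_steps_near.
have i1 : \int[P]_w (1 : R) = 1.
  transitivity (1 * fine (P setT)); first exact: Rintegral_cst.
  by rewrite probability_setT mulr1.
rewrite i1 in c2.
have c3 : `|\int[P]_w F (X t w) -
    \int[P]_w (F (X t w) * \prod_(l < N.+1) inside eps (X (grid t N l) w))|
    @[N --> \oo] -->
    `|\int[P]_w F (X t w) - \int[P]_w (F (X t w) * (`[< stays eps w >])%:R)|.
  by apply: cvg_norm; apply: (@cvgB _ R^o) => //; exact: cvg_cst.
have c4 : L * eps + M * (1 - \int[P]_w small_steps X t eps N w) @[N --> \oo] -->
    L * eps + M * (1 - 1).
  apply: (@cvgD _ R^o); first exact: cvg_cst.
  apply: cvgMr; apply: (@cvgB _ R^o) => //; exact: cvg_cst.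
rewrite subrr mulr0 addr0 in c4.
apply: (ler_cvg_to c3 c4); near=> N.
by apply: (exit_estimate BM mF FM L0 FL FN t0) => //; near: N; exact: nbhs_infty_gt.
Unshelve. all: by end_near. Qed.

(** The limit as [eps] tends to 0. A path that touches a wall without crossing it
    has left every level, so it counts as killed without a separate argument. *)
Lemma survival_expectation :
  \int[P]_w F (X t w) = \int[P]_w (F (X t w) * (`[< survives w >])%:R).
Proof.
have c1 : \int[P]_w (F (X t w) * (`[< stays (m.+1%:R^-1) w >])%:R)
    @[m --> \oo] --> \int[P]_w (F (X t w) * (`[< survives w >])%:R).
  apply: (@cvg_Rintegral_eventually _ _ _ P _ _ (cst M)) => //.
  - by move=> m; apply: measurable_funM => //; exact: measurable_stays.
  - by move=> m w; apply: norm_mul01 => //; rewrite ler0n lern1 leq_b1.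
  - by move=> w; apply: filterS (stays_near w) => m ->.
have c2 : `|\int[P]_w F (X t w) - \int[P]_w (F (X t w) * (`[< stays
  (m.+1%:R^-1) w >])%:R)|
    @[m --> \oo] -->
    `|\int[P]_w F (X t w) - \int[P]_w (F (X t w) * (`[< survives w >])%:R)|.
  by apply: cvg_norm; apply: (@cvgB _ R^o) => //; exact: cvg_cst.
have c3 : L * m.+1%:R^-1 @[m --> \oo] --> L * (0 : R).
  by apply: cvgMr; exact: cvg_harmonic.
rewrite mulr0 in c3.
apply/eqP; rewrite -subr_eq0 -normr_le0; apply: (ler_cvg_to c2 c3).
have H : \forall m \near \oo, forall i, m.+1%:R^-1 <= wall i eta.
  apply: filter_forall => i; near=> m.
  rewrite invf_ple ?posrE// -natr1 ler_wpDr//.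
  by near: m; exact: nbhs_infty_ger.
by apply: filterS H => m; apply: stays_estimate; rewrite invr_gt0.
Unshelve. all: by end_near. Qed.

End survival.

(** * Sets approximable by Lipschitz functions *)

Section lipschitz_approximable.
Context {R : realType} (n : nat).
Implicit Types (A : set 'rV[R]_n) (f : 'rV[R]_n -> R).

Definition l1_lipschitz f := exists2 L : R, 0 <= L &
  forall x y, `|f x - f y| <= L * l1dist x y.

(** The approximations vanish off [A]: for sets inside the open chamber they are
    test functions to which the reflection argument applies. *)
Definition lipschitz_approximable A := measurable A /\
  exists phi : nat -> 'rV[R]_n -> R,
  [/\ forall m, l1_lipschitz (phi m), forall m, measurable_fun setT (phi m),
      forall m x, 0 <= phi m x <= \1_A x &
      forall x, \forall m \near \oo, phi m x = \1_A x].

Lemma lipschitz_approximableT : lipschitz_approximable setT.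
Proof.
split; first exact: measurableT.
exists (fun _ _ => 1); split => //.
- move=> m; exists 0 => // x y; by rewrite subrr normr0 mul0r.
- by move=> m x; rewrite indicT lexx ler01.
- by move=> x; near=> m; rewrite indicT.
Unshelve. all: by end_near. Qed.

Lemma indic_le1 A x : \1_A x <= 1 :> R.
Proof. by rewrite indicE lern1 leq_b1. Qed.

Lemma lipschitz_approximableI : setI_closed lipschitz_approximable.
Proof.
move=> A B [mA [p [Lp mp p01 pA]]] [mB [q [Lq mq q01 qB]]].
split; first exact: measurableI.
(* A product of two bounded Lipschitz functions is Lipschitz. *)
exists (fun m x => p m x * q m x); split.
- move=> m; have [L L0 pL] := Lp m; have [L' L'0 qL] := Lq m.
  exists (L + L'); first exact: addr_ge0.
  move=> x y; have /andP[p0 p1] := p01 m y; have /andP[q0 q1] := q01 m x.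
  rewrite (_ : _ - _ = (p m x - p m y) * q m x + p m y * (q m x - q m y));
    last by ring.
  apply: (le_trans (ler_normD _ _)); rewrite [leRHS]mulrDl lerD// normrM.
    by rewrite -[leRHS]mulr1 ler_pM// ger0_norm// (le_trans q1)// indic_le1.
  by rewrite -[leRHS]mul1r ler_pM// ger0_norm// (le_trans p1)// indic_le1.
- by move=> m; exact: measurable_funM.
- move=> m x; have /andP[p0 p1] := p01 m x; have /andP[q0 q1] := q01 m x.
  rewrite mulr_ge0//= indicI /=; exact: ler_pM.
- move=> x; apply: filterS2 (pA x) (qB x) => m -> ->.
  by rewrite indicI.
Qed.

(** Use the truncations of [m * l x] to values between 0 and 1. *)
Lemma lipschitz_approximable_halfspace (l : 'rV[R]_n -> R) :
  measurable_fun setT l -> (forall x y, `|l x - l y| <= l1dist x y) ->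
  lipschitz_approximable [set x | 0 < l x].
Proof.
(* Truncation of the real line to [0, 1], which is 1-Lipschitz. *)
move=> ml lL; pose clip (u : R) := Num.min 1 (Num.max 0 u).
have clipE (u : R) : clip u = if u <= 0 then 0 else if 1 <= u then 1 else u.
  rewrite /clip; have [u0|u0] := leP u 0; first by rewrite min_r.
  by have [u1|u1] := leP 1 u.
have clip_nd u v : u <= v -> 0 <= clip v - clip u <= v - u.
  move=> uv; rewrite !clipE; have [u0|u0] := leP u 0; have [v0|v0] := leP v 0;
  have [u1|u1] := leP 1 u; have [v1|v1] := leP 1 v; apply/andP; split; lra.
have clipL u v : `|clip u - clip v| <= `|u - v|.
  have [/clip_nd/andP[c0 c1]|/ltW/clip_nd/andP[c0 c1]] := leP u v.
    by rewrite distrC [leRHS]distrC ger0_norm// (le_trans c1)// ler_norm.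
  by rewrite ger0_norm// (le_trans c1)// ler_norm.
split.
  rewrite (_ : [set x | _] = (fun x => 0 < l x) @^-1` [set true])//.
  rewrite -[X in measurable X]setTI; apply: measurable_fun_ltr => //.
exists (fun m x => clip (m%:R * l x)); split.
- move=> m; exists m%:R => // x y; apply: (le_trans (clipL _ _)).
  by rewrite -mulrBr normrM ger0_norm// ler_wpM2l.
- move=> m; apply: measurable_minr => //; apply: measurable_maxr => //.
  exact: measurable_funM.
- move=> m x; rewrite indicE clipE.
  have [lx|lx] := leP (l x) 0.
    by rewrite mulr_ge0_le0// lexx ler0n.
  rewrite mem_set//; case: ifPn => [_|]; first by rewrite lexx ler01.
  by rewrite -ltNge => h; case: ifPn => [_|]; rewrite ?lexx ?ler01// -ltNge =>
    /ltW ->; rewrite ltW.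
- move=> x; have [lx|lx] := leP (l x) 0.
    near=> m; rewrite clipE mulr_ge0_le0// indicE memNset//= => lx'.
    by move: lx; rewrite leNgt lx'.
  near=> m; rewrite indicE mem_set//.
  have m1 : 1 <= m%:R * l x.
    by rewrite -ler_pdivrMr// mul1r; near: m; exact: nbhs_infty_ger.
  by rewrite clipE m1 leNgt (lt_le_trans ltr01 m1).
Unshelve. all: by end_near. Qed.

(** Half-spaces orthogonal to the axes already generate the sigma-algebra. *)
Lemma measurable_lipschitz_approximable :
  measurable `<=` <<s lipschitz_approximable>>.
Proof.
apply: row_sigma_algebraW => i B mB.
pose H := [set C : set R | <<s lipschitz_approximable>> (row_coord i @^-1` C)].
suff GH : <<s @RGenOInfty.G R >> `<=` H.
  have mB' : (@ocitv R).-sigma.-measurable B := mB.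
  by rewrite RGenOInfty.measurableE in mB'; exact: GH.
apply: smallest_sub.
  have [s0 sC sU] :=
    @smallest_sigma_algebra _ [set: 'rV[R]_n] lipschitz_approximable.
  split.
  - by rewrite /H /= preimage_set0.
  - move=> C HC; rewrite /H /=; have := sC _ HC; congr (_ _).
  - by move=> C HC; rewrite /H /= preimage_bigcup; exact: sU.
move=> _ [a ->].
have HE : row_coord i @^-1` `]a, +oo[%classic =
  [set x : 'rV[R]_n | 0 < x ord0 i - a].
  by apply/seteqP; split => x; rewrite /row_coord/= in_itv/= andbT subr_gt0.
rewrite /H /mkset HE; apply: sub_sigma_algebra.
apply: lipschitz_approximable_halfspace.
  by apply: measurable_funB => //; exact: (@measurable_row_coord _ _ n i).
move=> x y; rewrite opprB addrA subrK /l1dist (bigD1 i)//= lerDl sumr_ge0//.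
Qed.

Definition open_chamber : set 'rV[R]_n := [set x | forall i, 0 < wall i x].

Lemma lipschitz_approximable_open_chamber : lipschitz_approximable open_chamber.
Proof.
have -> : open_chamber = \big[setI/setT]_(i < n) [set x | 0 < wall i x].
  rewrite -bigcap_seq; apply/seteqP; split => [x x0 i _|x x0 i]; first exact: x0.
  by apply: (x0 i); rewrite /= mem_index_enum.
apply: big_ind.
- exact: lipschitz_approximableT.
- exact: lipschitz_approximableI.
- move=> i _; apply: lipschitz_approximable_halfspace; first exact: measurable_wall.
  exact: wall_lipschitz.
Qed.

End lipschitz_approximable.

(** * The killed density *)

Section expansions.
Context {R : realType} (n : nat) (t : R).
Implicit Types (x eta : 'rV[R]_n).

(** Each entry is a signed sum over a choice of sign, so the Leibniz formula expands
    into an alternating sum over the hyperoctahedral group. *)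
Lemma det_heat x eta :
  \det (\matrix_(i < n, j < n) (heat_kernel t (x ord0 i - eta ord0 j)
        - heat_kernel t (x ord0 i + eta ord0 j))) =
  \sum_(w : signed_perm n)
    sgn w * \prod_i heat_kernel t (x ord0 i - act w eta ord0 i).
Proof.
rewrite /determinant -(pair_bigA _ (fun (s : 'S_n) (e : {ffun 'I_n -> bool}) =>
  sgn (s, e) * \prod_i heat_kernel t (x ord0 i - act (s, e) eta ord0 i))) /=.
apply: eq_bigr => s _.
under eq_bigr => i _.
  rewrite mxE (_ : _ - _ = \sum_(b : bool) (-1) ^+ b *
    heat_kernel t (x ord0 i - (-1) ^+ b * eta ord0 (s i))); last first.
    by rewrite big_bool/= mulN1r mulN1r opprK !mul1r addrC.
  over.
rewrite bigA_distr_bigA mulr_sumr; apply: eq_bigr => e _.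
rewrite /sgn big_split/= mulrA; congr (_ * _).
by apply: eq_bigr => i _; rewrite mxE.
Qed.

(** The same expansion without signs. *)
Lemma permanent_heat x eta :
  permanent (\matrix_(i < n, j < n) (heat_kernel t (x ord0 i - eta ord0 j)
        + heat_kernel t (x ord0 i + eta ord0 j))) =
  \sum_(w : signed_perm n)
    \prod_i heat_kernel t (x ord0 i - act w eta ord0 i).
Proof.
rewrite /permanent -(pair_bigA _ (fun (s : 'S_n) (e : {ffun 'I_n -> bool}) =>
  \prod_i heat_kernel t (x ord0 i - act (s, e) eta ord0 i))) /=.
apply: eq_bigr => s _.
under eq_bigr => i _.
  rewrite mxE (_ : _ + _ = \sum_(b : bool)
    heat_kernel t (x ord0 i - (-1) ^+ b * eta ord0 (s i))); last first.
    by rewrite big_bool/= mulN1r opprK !mul1r addrC.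
  over.
rewrite bigA_distr_bigA; apply: eq_bigr => e _.
by apply: eq_bigr => i _; rewrite mxE.
Qed.

End expansions.

Section orbit_law.
Context d (Omega : measurableType d) (R : realType) (P : probability Omega R).
Variables (n : nat) (X : R -> {RV P >-> 'rV[R]_n}) (eta : 'rV[R]_n) (t : R).
Hypotheses (BM : standard_brownian_motion eta X) (t0 : 0 < t).

Lemma act_pathE w o : act w (X t o) = act w (X t o - X 0 o) + act w eta.
Proof. by have [X0 _ _ _] := BM; rewrite -actD X0 subrK. Qed.

(** [X t] is [eta] plus a centred Gaussian row, and [act w] is linear. *)
Lemma orbit_density w (A : set 'rV[R]_n) : measurable A ->
  \int[P]_o \1_A (act w (X t o)) =
  \int[lebesgue_row n]_x (\prod_i heat_kernel t (x ord0 i - act w eta ord0 i) *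
    \1_A x).
Proof.
move=> mA; have [_ _ _ /(_ _ _ (lexx 0) t0)[ind law]] := BM.
have mw : measurable_fun setT (fun o => act w (X t o)).
  by apply: measurableT_comp => //; exact: measurable_act.
have lt : 0 < t - 0 by rewrite subr0.
have := gaussian_act_density lt (measurable_increment X 0 t) ind law w (act w
  eta) mA.
rewrite subr0 => <-; rewrite expectation_indic//; congr (fine (P _)).
by apply/seteqP; split => o; rewrite /= -act_pathE.
Qed.

Lemma integrable_orbit_density w (A : set 'rV[R]_n) : measurable A ->
  (lebesgue_row n).-integrable setT (EFin \o
    (fun x : 'rV[R]_n =>
      \prod_i heat_kernel t (x ord0 i - act w eta ord0 i) * \1_A x)).
Proof.
move=> mA; apply: (@integrable_mul_indic _ _ _ _ _ _ id) => //.
exact: integrable_heat_prod.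
Qed.

Lemma orbit_density_sum (c : signed_perm n -> R) (A : set 'rV[R]_n) :
  measurable A ->
  (\sum_w c w * \int[P]_o \1_A (act w (X t o)))%:E =
  (\int[lebesgue_row n]_(x in A)
    (\sum_w c w * \prod_i heat_kernel t (x ord0 i - act w eta ord0 i))%:E)%E.
Proof.
move=> mA; pose h w (x : 'rV[R]_n) : R :=
  c w * (\prod_i heat_kernel t (x ord0 i - act w eta ord0 i) * \1_A x).
have ih w : (lebesgue_row n).-integrable setT (EFin \o h w).
  rewrite (_ : _ \o _ = (fun x : 'rV[R]_n => (c w)%:E *
    (\prod_i heat_kernel t (x ord0 i - act w eta ord0 i) * \1_A x)%:E)%E)//.
  by apply: integrableZl => //; exact: integrable_orbit_density.
have -> : \sum_w c w * \int[P]_o \1_A (act w (X t o)) =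
    \int[lebesgue_row n]_x (\sum_w h w x).
  rewrite Rintegral_sum//; apply: eq_bigr => w _.
  by rewrite orbit_density// RintegralZl//; exact: integrable_orbit_density.
have iS : (lebesgue_row n).-integrable setT (EFin \o (fun x => \sum_w h w x)).
  rewrite (_ : _ \o _ = (fun x => \sum_w (h w x)%:E)%E).
    by apply: integrable_sum => // w _; exact: ih.
  by apply/funext => x; rewrite /= sumEFin.
rewrite /Rintegral fineK; last exact: integrable_fin_num.
rewrite [RHS]integral_mkcond; apply: eq_integral => x _.
rewrite patchE /h; case: ifPn => xA.
  by congr EFin; apply: eq_bigr => w _; rewrite indicE xA mulr1.
by rewrite big1// => w _; rewrite indicE (negbTE xA) !mulr0.
Qed.

End orbit_law.

Section killed.
Context d (Omega : measurableType d) (R : realType) (P : probability Omega R).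
Variables (n : nat) (X : R -> {RV P >-> 'rV[R]_n}) (eta : 'rV[R]_n) (t : R).
Hypotheses (BM : standard_brownian_motion eta X) (t0 : 0 < t).
Hypothesis eta0 : forall i, 0 < wall i eta.

Let D : set 'rV[R]_n := @open_chamber R n.

Let mD : measurable D.
Proof. by have [] := @lipschitz_approximable_open_chamber R n. Qed.

Let mact w : measurable_fun setT (fun o => act w (X t o)).
Proof. by apply: measurableT_comp => //; exact: measurable_act. Qed.

Let alive (o : Omega) : R := (`[< survives X t o >])%:R.

Let ialive : P.-integrable setT (EFin \o alive).
Proof.
apply: (@integrable_bounded _ _ _ _ _ 1); first exact: (measurable_survives BM t0).
by move=> o; rewrite ger0_norm ?ler0n// lern1 leq_b1.
Qed.

Lemma survives_end o : survives X t o -> D (X t o).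
Proof. by move=> s i; apply: s; rewrite lexx ltW. Qed.

(** Apply [survival_expectation] to the antisymmetrization of test functions that
    converge to the indicator of [A] in the open chamber. On a surviving path the
    antisymmetrization is the test function itself. *)
Lemma reflection_identity_approximable (A : set 'rV[R]_n) :
  lipschitz_approximable A ->
  \int[P]_o (alive o * \1_A (X t o)) =
  \sum_w sgn w * \int[P]_o \1_(A `&` D) (act w (X t o)).
Proof.
move=> LA; have [mAD [phi [Lphi mphi phi01 phiE]]] :=
  lipschitz_approximableI LA (@lipschitz_approximable_open_chamber R n).
have phi0 m y i : wall i y <= 0 -> phi m y = 0.
  move=> wy; apply/le_anti; have /andP[-> p] := phi01 m y; rewrite andbT.
  apply: (le_trans p); rewrite indicE memNset// => -[_ /(_ i)].
  by rewrite ltNge wy.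
have phi1 m y : `|phi m y| <= 1.
  by have /andP[p0 p1] := phi01 m y; rewrite ger0_norm// (le_trans p1)// indic_le1.
have i1 : P.-integrable setT (EFin \o cst (1 : R)).
  by apply: (@integrable_bounded _ _ _ _ _ 1) => // o; rewrite normr1.
have mphiw m w : measurable_fun setT (fun o => phi m (act w (X t o))).
  by apply: (measurableT_comp (mphi m)).
have E m : \sum_w sgn w * \int[P]_o phi m (act w (X t o)) =
    \int[P]_o (alive o * phi m (X t o)).
  have [L L0 pL] := Lphi m.
  have := @survival_expectation _ _ _ P n X eta t BM t0 (antisym (phi m)) _ _
    (measurable_antisym (mphi m)) (fun x => norm_antisym x (phi1 m))
    _ (fun x y => antisym_lipschitz x y pL)
    (fun i x => antisym_reflection (phi m) i x) eta0.
  rewrite mulr_ge0// => /(_ isT) S.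
  transitivity (\int[P]_o antisym (phi m) (X t o)).
    rewrite /antisym Rintegral_sum.
      apply: eq_bigr => w _; rewrite RintegralZl//.
      by apply: (@integrable_bounded _ _ _ _ _ 1).
    move=> w; apply: (@integrable_bounded _ _ _ _ _ 1).
      exact: measurable_funM.
    by move=> o; rewrite normrM norm_sgn mul1r.
  rewrite S; apply: eq_Rintegral => o _; rewrite /alive mulrC.
  case: asboolP => [/survives_end so|_]; last by rewrite !mul0r.
  by rewrite antisym_interior// => y i; exact: phi0.
have c1 : \sum_w sgn w * \int[P]_o phi m (act w (X t o)) @[m --> \oo] -->
    \sum_w sgn w * \int[P]_o \1_(A `&` D) (act w (X t o)).
  apply: cvg_big => [|w _]; first exact: add_continuous.
  apply: cvgMr; apply: (@cvg_Rintegral_eventually _ _ _ P _ _ (cst 1)).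
  - by move=> m; exact: mphiw.
  - exact: i1.
  - by move=> m o; exact: phi1.
  - by move=> o; exact: phiE.
have c2 : \int[P]_o (alive o * phi m (X t o)) @[m --> \oo] -->
    \int[P]_o (alive o * \1_(A `&` D) (X t o)).
  apply: (@cvg_Rintegral_eventually _ _ _ P _ _ (cst 1)) => //.
  - move=> m; apply: measurable_funM; first exact: (measurable_survives BM t0).
    exact: measurableT_comp.
  - move=> m o; rewrite normrM /alive mulr_ile1// ger0_norm// lern1 leq_b1//.
  - by move=> o; apply: filterS (phiE (X t o)) => m ->.
rewrite (_ : (fun m => _) = (fun m =>
  \int[P]_o (alive o * phi m (X t o)))) in c1; last first.
  by apply/funext => m; exact: E.
rewrite (cvg_unique _ c1 c2)//.
apply: eq_Rintegral => o _; rewrite /alive.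
case: asboolP => [/survives_end so|_]; last by rewrite !mul0r.
by rewrite indicI/= [X in _ * (_ * X)]indicE mem_set// mulr1.
Qed.

(** Both sides are signed measures in [A]. *)
Lemma reflection_identity (A : set 'rV[R]_n) : measurable A ->
  \int[P]_o (alive o * \1_A (X t o)) =
  \sum_w sgn w * \int[P]_o \1_(A `&` D) (act w (X t o)).
Proof.
move: A; apply: (@signed_measure_unique _ _ _ (@lipschitz_approximable R n)).
- exact: lipschitz_approximableI.
- exact: lipschitz_approximableT.
- by move=> A [].
- exact: measurable_lipschitz_approximable.
- by apply: signed_measure_integral.
- apply: signed_measure_sum => w; apply: signed_measureZ.
  have iD : P.-integrable setT (EFin \o (fun o => \1_D (act w (X t o)) : R)).
    apply: (@integrable_bounded _ _ _ _ _ 1).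
      by apply: (measurableT_comp _ (mact w)); exact: measurable_indic.
    by move=> o; rewrite ger0_norm// indic_le1.
  rewrite (_ : (fun A => _) =
      (fun A => \int[P]_o (\1_D (act w (X t o)) * \1_A (act w (X t o))))).
    exact: signed_measure_integral.
  by apply/funext => A; apply: eq_Rintegral => o _; rewrite indicI mulrC.
- exact: reflection_identity_approximable.
Qed.

Lemma killed_lawE (A : set 'rV[R]_n) : measurable A ->
  killed_law X t A = (\int[P]_o (alive o * \1_A (X t o)))%:E.
Proof.
move=> mA.
have mS : measurable [set o | survives X t o].
  rewrite (_ : [set o | _] = alive @^-1` [set 1]).
    rewrite -[X in measurable X]setTI; apply: (measurable_survives BM t0) => //.
  apply/seteqP; split => o; rewrite /alive /=.
    by move=> /asboolP ->.
  by case: asboolP => // _ /eqP; rewrite eq_sym oner_eq0.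
have mXA : measurable (X t @^-1` A).
  by rewrite -[X in measurable X]setTI; exact: measurable_funP.
have -> : killed_law X t A = P ((X t @^-1` A) `&` [set o | survives X t o]).
  congr (P _); apply/seteqP; split => o [Ao so]; split => // s st.
    by apply/interior_weyl_chamberP; exact: so.
  by apply/interior_weyl_chamberP; exact: so.
rewrite -[LHS]fineK ?fin_num_measure//; last exact: measurableI.
congr EFin; rewrite -[X in P X]setIT -integral_indic//; last exact: measurableI.
congr fine; apply: eq_integral => o _; by rewrite indicI/= mulrC; congr (_ * _)%:E.
Qed.

End killed.

(** * Folding into the chamber *)

Section folding.
Context {R : realType} (n : nat).
Implicit Types (x : 'rV[R]_n) (A : set 'rV[R]_n).

Lemma hyperoctahedral_orbitP x y :
  hyperoctahedral_orbit x y <-> exists w, y = act w x.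
Proof.
split=> [[s [e ->]]|[w ->]].
  by exists (s, [ffun i => e i]); apply/rowP => i; rewrite !mxE ffunE.
by exists w.1, w.2.
Qed.

Lemma chamber_foldP x : @weyl_chamber R n (chamber_fold x) /\ exists w,
  chamber_fold x = act w x.
Proof.
have [w Cw] := signed_perm_exists x.
have : (@weyl_chamber R n `&` hyperoctahedral_orbit x) (chamber_fold x).
  apply: (@getI _ _ (act w x)); split => //.
  by apply/hyperoctahedral_orbitP; exists w.
by move=> [C /hyperoctahedral_orbitP].
Qed.

(** The orbit of [x] meets the chamber in exactly one point, which may be reached by
    several group elements. *)
Lemma preimage_chamber_fold A :
  @chamber_fold R n @^-1` A = \bigcup_(w in [set: signed_perm n])
    (act w @^-1` (A `&` @weyl_chamber R n)).
Proof.
apply/seteqP; split => x /=.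
  have [C [w fE]] := chamber_foldP x.
  by rewrite fE in C * => Ax; exists w.
move=> [w _ [Aw Cw]]; have [C [v fE]] := chamber_foldP x.
by rewrite fE in C *; rewrite (act_chamber_unique C Cw).
Qed.

Lemma measurable_weyl_chamber : measurable (@weyl_chamber R n).
Proof.
rewrite (_ : @weyl_chamber R n =
  \bigcap_(i in [set: 'I_n]) (wall i @^-1` `[0, +oo[)).
  apply: fin_bigcap_measurable => // i _.
  by rewrite -[X in measurable X]setTI; apply: measurable_wall => //;
    exact: measurable_itv.
apply/seteqP; split => x.
  by move=> /weyl_chamberP x0 i _; rewrite /= in_itv/= andbT.
move=> x0; apply/weyl_chamberP => i.
by have := x0 i Logic.I; rewrite /= in_itv/= andbT.
Qed.

Lemma measurable_preimage_act w A : measurable A -> measurable (act w @^-1` A).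
Proof.
by move=> mA; rewrite -[X in measurable X]setTI; exact: measurable_act.
Qed.

End folding.

Section boundary.
Context d (Omega : measurableType d) (R : realType) (P : probability Omega R).
Variables (n : nat) (t : R) (xi : Omega -> 'rV[R]_n).
Local Notation mu := (@lebesgue_measure R).
Hypotheses (t0 : 0 < t) (mxi : measurable_fun setT xi)
  (ind : mutually_independent P (fun i w => xi w ord0 i))
  (law : forall i, has_normal_law P 0 (Num.sqrt t) (fun w => xi w ord0 i)).
Variables (g : signed_perm n) (c : 'rV[R]_n).

Let Y w := act g (xi w) + c.

Let mY : measurable_fun setT Y.
Proof.
apply: measurable_row_add => //.
by apply: measurableT_comp => //; exact: measurable_act.
Qed.

Let mYi i : measurable_fun setT (fun w => Y w ord0 i).
Proof. exact: (measurableT_comp (@measurable_row_coord _ _ n i) mY). Qed.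

Let heatE i (B : set R) :
  (\int[mu]_(x in B) (heat_kernel t (x - c ord0 i))%:E)%E =
  normal_prob (c ord0 i) (Num.sqrt t) B.
Proof. by apply: eq_integral => x _; rewrite heat_kernelE. Qed.

Lemma coordinate_null i (a : R) : P [set w | Y w ord0 i = a] = 0%E.
Proof.
have -> : [set w | Y w ord0 i = a] =
    Y @^-1` box (fun j => if j == i then [set a] else setT).
  apply/seteqP; split => w /=.
    by move=> Ya j; case: eqP => // ->.
  by move=> /(_ i); rewrite eqxx.
rewrite (gaussian_act_box t0 ind law)//; last first.
  by move=> j; case: ifP => // _; exact: measurable_set1.
rewrite (bigD1 i)//= eqxx.
have -> : (\int[mu]_(x in [set a]) (heat_kernel t (x - c ord0 i))%:E = 0)%E.
  exact: integral_set1.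
by rewrite mul0e.
Qed.

(** The joint law of two coordinates is a product of laws without atoms, and the
    sections of the diagonal are points. *)
Lemma coordinates_distinct i j : i != j -> P [set w | Y w ord0 i =
  Y w ord0 j] = 0%E.
Proof.
move=> ij; pose m k : probability (measurableTypeR R) R :=
  normal_prob (c ord0 k) (Num.sqrt t).
have mp : measurable_fun setT (fun w =>
  (Y w ord0 i, Y w ord0 j) : measurableTypeR R * measurableTypeR R).
  by apply/measurable_fun_pairP; split; [exact: mYi|exact: mYi].
have E A B : measurable A -> measurable B ->
    image_measure P mp (A `*` B) = (m i A * m j B)%E.
  move=> mA mB; rewrite /= /pushforward.
  have -> : (fun w => (Y w ord0 i, Y w ord0 j)) @^-1` (A `*` B) =
      Y @^-1` box (fun k => if k == i then A else if k == j then B else setT).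
    apply/seteqP; split => w /=.
      by move=> [Ai Bj] k; case: eqP => [->//|_]; case: eqP => [->|].
    move=> H; split; first by have := H i; rewrite eqxx.
    by have := H j; rewrite (negbTE (_ : j != i)) 1?eq_sym// eqxx.
  rewrite (gaussian_act_box t0 ind law)//; last first.
    by move=> k; case: ifP => // _; case: ifP.
  rewrite (bigD1 i)//= eqxx (bigD1 j)/=; last by rewrite eq_sym.
  rewrite (negbTE (_ : j != i)) 1?eq_sym// eqxx !heatE big1 ?mule1//.
  move=> k /andP[/negbTE -> /negbTE ->]; rewrite heatE.
  exact: probability_setT.
(* The diagonal is null for the product of the two laws. *)
pose diag := [set p : measurableTypeR R * measurableTypeR R | p.1 = p.2].
have mdiag : measurable diag.
  rewrite (_ : diag = (fun p => p.1 - p.2 : measurableTypeR R) @^-1` [set 0]).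
    rewrite -[X in measurable X]setTI.
    apply: measurable_funB => //; exact: measurable_set1.
  apply/seteqP; split => p; rewrite /diag/=; first by move=> ->; rewrite subrr.
  by move/subr0_eq.
transitivity (image_measure P mp diag); first by [].
rewrite -(product_measure_unique E)//.
rewrite /product_measure1; apply: integral0_eq => x _ /=.
rewrite (_ : xsection diag x = [set x]); last first.
  by apply/seteqP; split => y; rewrite /xsection/diag/= inE.
rewrite /normal_prob; exact: integral_set1.
Qed.

(** A boundary point lies on one of the walls, that is, has two equal coordinates or
    a zero coordinate. *)
Lemma boundary_null : P (Y @^-1` (@weyl_chamber R n `\` @open_chamber R n)) = 0%E.
Proof.
have null i : P [set w | wall i (Y w) = 0] = 0%E.
  rewrite /wall /entry; case: insubP => [j _ ji|_]; last first.
    rewrite -[RHS](coordinate_null i 0); congr (P _).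
    by apply/seteqP; split => w /=; rewrite subr0.
  have ij : i != j by rewrite -val_eqE/= ji ltn_eqF.
  rewrite -[RHS](coordinates_distinct ij); congr (P _).
  by apply/seteqP; split => w /=; [move/subr0_eq|move=> ->; rewrite subrr].
have mwall i : measurable [set w | wall i (Y w) = 0].
  have mw := measurableT_comp (measurable_wall i) mY.
  by have := mw measurableT [set 0] (measurable_set1 0); rewrite setTI.
pose B (s : seq 'I_n) := \big[setU/set0]_(i <- s) [set w | wall i (Y w) = 0].
have [mB B0] : measurable (B (index_enum 'I_n)) /\ P (B (index_enum 'I_n)) = 0%E.
  elim: (index_enum _) => [|i s [mBs Bs0]]; rewrite /B ?big_nil ?big_cons.
    by split; [exact: measurable0|exact: measure0].
  split; first by apply: measurableU => //; exact: mwall.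
  by apply: null_set_setU => //; exact: null.
apply: (@subset_measure0 _ _ _ P _ _ _ mB _ B0).
- rewrite -[X in measurable X]setTI; apply: mY => //; apply: measurableD.
    exact: measurable_weyl_chamber.
  by have [] := @lipschitz_approximable_open_chamber R n.
- move=> w [/weyl_chamberP C nD].
  have [i wi] : exists i, ~ 0 < wall i (Y w) by apply/existsNP.
  rewrite /B -bigcup_seq; exists i; first by rewrite /= mem_index_enum.
  by apply/le_anti; rewrite C andbT leNgt; apply/negP.
Qed.

End boundary.

(** * The reflected density *)

Section reflected.
Context d (Omega : measurableType d) (R : realType) (P : probability Omega R).
Variables (n : nat) (X : R -> {RV P >-> 'rV[R]_n}) (eta : 'rV[R]_n) (t : R).
Hypotheses (BM : standard_brownian_motion eta X) (t0 : 0 < t).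

Let C : set 'rV[R]_n := @weyl_chamber R n.
Let D : set 'rV[R]_n := @open_chamber R n.

Let mC : measurable C. Proof. exact: measurable_weyl_chamber. Qed.

Let mD : measurable D.
Proof. by have [] := @lipschitz_approximable_open_chamber R n. Qed.

Let DC : D `<=` C.
Proof. by move=> x x0; apply/weyl_chamberP => i; exact: ltW. Qed.

(** At most one group element carries [x] into the open chamber. *)
Lemma sum_orbit_le (A : set 'rV[R]_n) x :
  \sum_w \1_(A `&` D) (act w x) <= \1_(@chamber_fold R n @^-1` A) x :> R.
Proof.
rewrite preimage_chamber_fold.
have [[w [Aw Dw]]|H] := pselect (exists w, (A `&` D) (act w x)); last first.
  by rewrite big1// => w _; rewrite indicE memNset// => Aw; apply: H; exists w.
rewrite (bigD1 w)//= big1 ?addr0 => [|v vw].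
  rewrite !indicE mem_set// mem_set//; exists w => //; split => //; exact: DC.
rewrite indicE memNset// => -[_ Dv]; move/eqP: vw; apply.
exact: (act_interior_inj Dv Dw).
Qed.

Lemma le_sum_orbit (A : set 'rV[R]_n) x :
  \1_(@chamber_fold R n @^-1` A) x <=
  \sum_w (\1_(A `&` D) (act w x) + \1_(C `\` D) (act w x)) :> R.
Proof.
rewrite preimage_chamber_fold indicE.
have t_ge0 v : 0 <= \1_(A `&` D) (act v x) + \1_(C `\` D) (act v x) :> R.
  by rewrite addr_ge0.
have [|_] := boolP (x \in _); last exact: sumr_ge0.
rewrite inE => -[w _ [Aw Cw]]; rewrite (bigD1 w)//=.
apply: (@le_trans _ _ (\1_(A `&` D) (act w x) + \1_(C `\` D) (act w x)));
  last first.
  by rewrite lerDl sumr_ge0.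
have [Dw|nDw] := pselect (D (act w x)).
  by rewrite indicE mem_set// lerDl.
by rewrite [X in _ + X]indicE mem_set// lerDr.
Qed.

(** The law of the folded point is squeezed between the two sums over the orbit,
    which differ by the probability of hitting the boundary. *)
Lemma reflected_lawE (A : set 'rV[R]_n) : measurable A ->
  reflected_law X t A = (\sum_w \int[P]_o \1_(A `&` D) (act w (X t o)))%:E.
Proof.
move=> mA; have mS : measurable (@chamber_fold R n @^-1` A).
  rewrite preimage_chamber_fold; apply: fin_bigcup_measurable => [|w _];
    first exact: finite_finset.
  by apply: measurable_preimage_act; exact: measurableI.
have mXS : measurable (X t @^-1` (@chamber_fold R n @^-1` A)).
  by rewrite -[X in measurable X]setTI; exact: measurable_funP.
have mact w : measurable_fun setT (fun o => act w (X t o)).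
  by apply: measurableT_comp => //; exact: measurable_act.
have i1 (Y : Omega -> 'rV[R]_n) (B : set 'rV[R]_n) : measurable_fun setT Y ->
  measurable B ->
    P.-integrable setT (EFin \o (fun o => \1_B (Y o) : R)).
  move=> mY mB; apply: (@integrable_bounded _ _ _ _ _ 1).
    by apply: (measurableT_comp _ mY); exact: measurable_indic.
  by move=> o; rewrite ger0_norm// indic_le1.
transitivity (\int[P]_o \1_(@chamber_fold R n @^-1` A) (X t o))%:E.
  by rewrite expectation_indic// fineK// fin_num_measure.
congr EFin; have iAD w := i1 _ _ (mact w) (measurableI _ _ mA mD).
have iCD w := i1 _ _ (mact w) (measurableD mC mD).
have mXt : measurable_fun setT (X t) by [].
have iS := i1 _ _ mXt mS.
have iADCD w : P.-integrable setT (EFin \o (fun o =>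
    \1_(A `&` D) (act w (X t o)) + \1_(C `\` D) (act w (X t o)) : R)).
  rewrite (_ : _ \o _ = (fun o => (\1_(A `&` D) (act w (X t o)))%:E +
    (\1_(C `\` D) (act w (X t o)))%:E)%E)//.
  exact: (integrableD measurableT (iAD w) (iCD w)).
have isum (h : signed_perm n -> Omega -> R) : (forall w, P.-integrable setT
  (EFin \o h w)) ->
    P.-integrable setT (EFin \o (fun o => \sum_w h w o)).
  move=> ih; rewrite (_ : _ \o _ = (fun o => \sum_w (h w o)%:E)%E).
    by apply: integrable_sum => // w _; exact: ih.
  by apply/funext => o; rewrite /= sumEFin.
apply/le_anti/andP; split; last first.
  rewrite -Rintegral_sum//; apply: le_Rintegral => //; first exact: isum.
  by move=> o _; exact: sum_orbit_le.
apply: (@le_trans _ _ (\int[P]_o \sum_w (\1_(A `&` D) (act w (X t o)) +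
    \1_(C `\` D) (act w (X t o))))).
  apply: le_Rintegral => //; first exact: isum.
  by move=> o _; exact: le_sum_orbit.
rewrite Rintegral_sum//; apply: ler_sum => w _.
rewrite RintegralD// gerDl expectation_indic//; last exact: measurableD.
have [_ _ _ /(_ _ _ (lexx 0) t0)[ind law]] := BM.
have lt : 0 < t - 0 by rewrite subr0.
have := boundary_null lt (measurable_increment X 0 t) ind law w (act w eta).
rewrite (_ : (fun o => _) @^-1` _ = (fun o => act w (X t o)) @^-1` (C `\` D)).
  by move=> ->.
by apply/seteqP; split => o; rewrite /= -(act_pathE t BM).
Qed.

End reflected.

Section continuity.
Context {R : realType} (n : nat) (t : R) (eta : 'rV[R]_n).

Lemma heat_orbit_continuous (c : signed_perm n -> R) : 0 < t ->
  continuous (fun x : 'rV[R]_n =>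
    \sum_w c w * \prod_i heat_kernel t (x ord0 i - act w eta ord0 i)).
Proof.
move=> t0 x; apply: (@cvg_big _ _ _ _ _ (@add_continuous R) _ (nbhs x)) => w _.
apply: (@cvgMr _ _ (nbhs x));
  apply: (@cvg_big _ _ _ _ _ (@mul_continuous R) _ (nbhs x)) => i _.
have h : continuous (fun a : R => heat_kernel t (a - act w eta ord0 i)).
  rewrite (_ : (fun _ => _) = normal_pdf (act w eta ord0 i) (Num.sqrt t)).
    by apply: continuous_normal_pdf; rewrite gt_eqF// sqrtr_gt0.
  by apply/funext => a; rewrite heat_kernelE.
have c1 := @coord_continuous R 1 n ord0 i x.
exact: (cvg_comp _ _ c1 (h (x ord0 i))).
Qed.

End continuity.

Unset Implicit Arguments.
Set Strict Implicit.
Set Printing Implicit Defensive.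

Theorem mainTheorem4 (R : realType) (n : nat) (d : measure_display)
    (Omega : measurableType d) (P : probability Omega R)
    (X : R -> {RV P >-> 'rV[R]_n}) (eta : 'rV[R]_n) (t : R) :
  (1 <= n)%N ->
  interior (@weyl_chamber R n) eta ->
  standard_brownian_motion eta X ->
  0 < t ->
  has_density (killed_law X t) (interior (@weyl_chamber R n))
    (fun lambda => \det (\matrix_(i < n, j < n)
       (heat_kernel t (lambda ord0 i - eta ord0 j)
        - heat_kernel t (lambda ord0 i + eta ord0 j)))) /\
  has_density (reflected_law X t) (interior (@weyl_chamber R n))
    (fun lambda => permanent (\matrix_(i < n, j < n)
       (heat_kernel t (lambda ord0 i - eta ord0 j)
        + heat_kernel t (lambda ord0 i + eta ord0 j)))).
Proof.
move=> _ /interior_weyl_chamberP eta0 BM t0.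
have -> : interior (@weyl_chamber R n) = @open_chamber R n.
  by apply/seteqP; split => x /interior_weyl_chamberP.
have mD : measurable (@open_chamber R n).
  by have [] := @lipschitz_approximable_open_chamber R n.
split; split.
- apply: continuous_subspaceT.
  under eq_fun do rewrite det_heat; exact: heat_orbit_continuous.
- move=> A mA; rewrite (killed_lawE BM t0)// (reflection_identity BM t0)//.
  rewrite (orbit_density_sum BM t0)//; last exact: measurableI.
  by apply: eq_integral => x _; rewrite det_heat.
- apply: continuous_subspaceT.
  under eq_fun do rewrite permanent_heat.
  have := @heat_orbit_continuous R n t eta (fun=> 1) t0.
  by under eq_fun do under eq_bigr do rewrite mul1r.
- move=> A mA; rewrite (reflected_lawE BM t0)//.
  have := orbit_density_sum BM t0 (fun=> 1) (measurableI _ _ mA mD).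
  under eq_bigr do rewrite mul1r.
  move=> ->; apply: eq_integral => x _; rewrite permanent_heat; congr EFin.
  by apply: eq_bigr => w _; rewrite mul1r.
Qed.
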